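(* Let $X$ be an affine spherical $G$-variety and let $Y\subset X$ be a subvariety that intersects the open $G$-orbit. Let $\mathbf{Trop}:Y^{\mathrm{an}}\to\hat{\mathcal{V}}_X$, $p\mapsto\bar v_p$, be the spherical tropicalization map on the analytification of $Y$. Then: (1) The map $\mathbf{Trop}:Y^{\mathrm{an}}\to\hat{\mathcal V}_X$ is continuous. (2) The map $\mathbf{Trop}$ extends the tropicalization map $\mathrm{Trop}:Y(\mathcal K)\to\mathcal V_X$, $\gamma\mapsto\bar v_\gamma$. That is, the triangle formed by the natural embedding $j:Y(\mathcal K)\hookrightarrow Y^{\mathrm{an}}$, the map $\mathbf{Trop}:Y^{\mathrm{an}}\to\hat{\mathcal V}_X$ and the map $\mathrm{Trop}$ from $Y(\mathcal K)$ to $\hat{\mathcal V}_X$ (via $\mathcal V_X\subset\hat{\mathcal V}_X$) commutes: $\mathbf{Trop}\circ j=\mathrm{Trop}$.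
   Context: $\mathbf{k}$ is an algebraically closed field of characteristic $0$; $G$ is a connected reductive algebraic group over $\mathbf{k}$; a $G$-variety is spherical if a Borel subgroup of $G$ has a dense open orbit. $\mathcal{K}=\mathbf{k}((t))$ is the field of formal Laurent series with its valuation $\mathrm{ord}_t:\mathcal K\to\mathbb Z\cup\{\infty\}$. $A=\mathbf{k}[X]$, and $\pi:A\to\mathbf{k}[Y]$ is the algebra homomorphism induced by the inclusion of $Y$ in $X$. $\mathcal V_X$ is the set of $G$-invariant valuations on the field $\mathbf{k}(X)$ with values in $\mathbb Q$, and $\hat{\mathcal{V}}_X$ is the set of all $G$-invariant valuations $v:\mathbf{k}(X)\to\mathbb{R}\cup\{\infty\}$. Continuity of a map to $\hat{\mathcal V}_X$ is tested on the evaluations $v\mapsto v(f)$, $f\in A$. $Y^{\mathrm{an}}$ is the set of multiplicative seminorms on $\mathbf{k}[Y]\otimes_{\mathbf{k}}\mathcal{K}$, i.e. functions $p:\mathbf{k}[Y]\otimes_{\mathbf{k}}\mathcal{K}\to\mathbb{R}_{\ge0}$ with $p(fg)=p(f)p(g)$, $p(\lambda)=\exp(-\mathrm{ord}_t(\lambda))$ for $\lambda\in\mathcal K$, and $p(f+g)\le\max(p(f),p(g))$; it has the coarsest topology in which all maps $p\mapsto p(f)$, $f\in\mathbf{k}[Y]\otimes_{\mathbf{k}}\mathcal{K}$, are continuous. For $p\in Y^{\mathrm{an}}$, $v_p:\mathbf{k}[Y]\to\mathbb{R}\cup\{\infty\}$ is the valuation $v_p(f)=-\log(p(f))$. For a valuation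 $v:\mathbf{k}[Y]\to\mathbb{R}\cup\{\infty\}$, $\bar v:A\to\mathbb{R}\cup\{\infty\}$ is the valuation defined by $\bar v(f)=v(\pi(g\cdot f))$ for $g$ in some Zariski open subset $U_f\subset G$. For $p\in Y^{\mathrm{an}}$, $\bar v_p$ is the $G$-invariant valuation on $\mathbf{k}(X)$ associated in this way to $v_p$. For $\gamma\in Y(\mathcal K)$, $j(\gamma)$ is the multiplicative seminorm $j(\gamma)(f)=\exp(-\mathrm{ord}_t(f(\gamma)))$, and $\mathrm{Trop}(\gamma)=\bar v_\gamma$ is the $G$-invariant valuation with $\bar v_\gamma(f)=\mathrm{ord}_t(f(g\cdot\gamma(t)))$ for every $0\ne f\in A$ and $g\in G$ in general position.
   Formalization: Valuations in the target are taken on k[X], with ∞ allowed on nonzero functions, since v̄_p can be ∞ there (G_m on A^1, p=j(0)); when the center of p or γ meets the open orbit, v̄ is shown to extend to a G-invariant valuation of k(X), with values in Q for γ. *)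

(* Defs.v *)
From HB Require Import structures.
From mathcomp Require Import all_boot all_order all_algebra.
From mathcomp Require Import all_classical all_reals all_analysis.
From mathcomp Require Import -(notations) mpoly.
From mathcomp Require Import lra.
Set Implicit Arguments.
Unset Strict Implicit.
Unset Printing Implicit Defensive.
Import Order.TTheory GRing.Theory Num.Theory numFieldNormedType.Exports.
Local Open Scope classical_set_scope.
Local Open Scope ring_scope.

(* In a commutative ring, units and inverses exist classically; this is only
   used to reach [idomainType], hence {fraction _}. *)
Section ClassicalUnits.
Variable A : comNzRingType.
Definition cunit : pred A := fun x => `[< exists y, y * x = 1 >].
Definition cinv (x : A) : A :=
  if x \in cunit then xget 0 [set y | y * x = 1] else x.
Lemma cunit_mulVr : {in cunit, left_inverse 1 cinv *%R}.
Proof.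
move=> x Ux; rewrite /cinv Ux; move/asboolP: Ux => -[y yx].
by case: xgetP => [z _ //|/(_ y)/(_ yx)].
Qed.
Lemma cunitPl x y : y * x = 1 -> x \in cunit.
Proof. by move=> yx; apply/asboolP; exists y. Qed.
Lemma cinv_out : {in [predC cunit], cinv =1 id}.
Proof. by move=> x; rewrite inE /cinv => /negbTE ->. Qed.
End ClassicalUnits.

(* k[[t]]: a : nat -> k is the series \sum_i a_i t^i. *)
Section PowerSeries.
Variable k : fieldType.
Definition powser : Type := nat -> k.
HB.instance Definition _ := GRing.Zmodule.copy powser (nat -> k).
Implicit Types a b c : powser.

Definition powser_const (x : k) : powser := fun i => if i is 0%N then x else 0.
Definition powser_mul a b : powser :=
  fun n => \sum_(i < n.+1) a i * b (n - i)%N.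

Lemma powser_mulC : commutative powser_mul.
Proof.
move=> a b; apply/funext => n; rewrite /powser_mul.
rewrite (reindex_inj rev_ord_inj) /=; apply: eq_bigr => i _.
by rewrite mulrC subSS subKn // -ltnS.
Qed.
Lemma powser_mul_poly a b n N : (n < N)%N ->
  powser_mul a b n = ((\poly_(i < N) a i) * (\poly_(i < N) b i))`_n.
Proof.
move=> nN; rewrite coefM; apply: eq_bigr => i _; rewrite !coef_poly.
rewrite (leq_ltn_trans _ nN) ?(leq_ltn_trans _ nN) // ?leq_subr //.
by rewrite -ltnS.
Qed.
Lemma powser_mulA : associative powser_mul.
Proof.
move=> a b c; apply/funext => n; rewrite !(@powser_mul_poly _ _ _ n.+1) //.
transitivity (((\poly_(i < n.+1) a i) * ((\poly_(i < n.+1) b i)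
   * (\poly_(i < n.+1) c i)))`_n); last rewrite mulrA.
  rewrite !coefM; apply: eq_bigr => i _; congr (_ * _).
  rewrite coef_poly ltnS leq_subr (@powser_mul_poly _ _ _ n.+1) //.
  by rewrite ltnS leq_subr.
rewrite !coefM; apply: eq_bigr => i _; congr (_ * _).
by rewrite coef_poly ltn_ord (@powser_mul_poly _ _ _ n.+1) // ltn_ord.
Qed.
Lemma powser_mul1 : left_id (powser_const 1) powser_mul.
Proof.
move=> a; apply/funext => n; rewrite /powser_mul big_ord_recl /= mul1r subn0.
by rewrite big1 ?addr0 // => i _; rewrite mul0r.
Qed.
Lemma powser_mulDl : left_distributive powser_mul +%R.
Proof.
move=> a b c; apply/funext => n.
by rewrite -[RHS]/(_ + _) -big_split; apply: eq_bigr => i _; exact: mulrDl.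
Qed.
Lemma powser_const1_neq0 : powser_const 1 != 0 :> powser.
Proof. by apply/eqP => /(congr1 (fun a : powser => a 0%N))/eqP; rewrite /= oner_eq0. Qed.

HB.instance Definition _ := GRing.Zmodule_isComNzRing.Build powser
  powser_mulA powser_mulC powser_mul1 powser_mulDl powser_const1_neq0.

Lemma powser_const_monoid : monoid_morphism powser_const.
Proof.
split=> // x y; apply/funext => -[|n]; rewrite -[RHS]/(powser_mul _ _ _) /powser_mul.
  by rewrite big_ord1.
by rewrite big1 // => i _; case: i => -[|i] ilt /=; rewrite ?mulr0 ?mul0r.
Qed.
Lemma powser_const_zmod : zmod_morphism powser_const.
Proof. by move=> x y; apply/funext => -[|n] //; rewrite [RHS]subr0. Qed.
HB.instance Definition _ :=
  GRing.isZmodMorphism.Build k powser powser_const powser_const_zmod.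
HB.instance Definition _ :=
  GRing.isMonoidMorphism.Build k powser powser_const powser_const_monoid.

HB.instance Definition _ := GRing.ComNzRing_hasMulInverse.Build powser
  (@cunit_mulVr powser) (@cunitPl powser) (@cinv_out powser).

Lemma powser_neq0 a : a != 0 -> exists n, a n != 0.
Proof.
move=> /eqP a0; apply: contrapT => h; apply: a0; apply/funext => n.
by apply/eqP; apply: contrapT => /negP h'; apply: h; exists n.
Qed.

(* the order of vanishing, with the junk value 0 at the zero series *)
Definition powser_ord a : nat :=
  if pselect (exists n, a n != 0) is left ex then ex_minn ex else 0%N.

Lemma powser_ordP a : a != 0 ->
  a (powser_ord a) != 0 /\ forall i, (i < powser_ord a)%N -> a i = 0.
Proof.
move=> /powser_neq0 h; rewrite /powser_ord; case: pselect => // ex.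
case: ex_minnP => n an min; split=> // i; apply: contraTeq.
by rewrite -leqNgt; apply: min.
Qed.
Lemma powser_ord_uniq a n :
  a n != 0 -> (forall i, (i < n)%N -> a i = 0) -> powser_ord a = n.
Proof.
move=> an lt; have a0 : a != 0 by apply: contraNneq an => ->.
have [h1 h2] := powser_ordP a0.
case: (ltngtP (powser_ord a) n) => // h; first by rewrite lt ?eqxx in h1.
by rewrite h2 ?eqxx in an.
Qed.
Lemma powser_mul_lead a b : a != 0 -> b != 0 ->
  (a * b) (powser_ord a + powser_ord b)%N
    = a (powser_ord a) * b (powser_ord b) /\
  forall i, (i < powser_ord a + powser_ord b)%N -> (a * b) i = 0.
Proof.
move=> /powser_ordP[a0 la] /powser_ordP[b0 lb]; split.
  rewrite -[LHS]/(powser_mul _ _ _) /powser_mul; have h : (powser_ord a < (powser_ord a + powser_ord b).+1)%N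
    by rewrite ltnS leq_addr.
  rewrite (bigD1 (Ordinal h)) //= addKn big1 ?addr0 // => i ne.
  case: (ltngtP i (powser_ord a)) => hi; first by rewrite la ?mul0r.
    rewrite lb ?mulr0 // ltn_subLR; last by rewrite -ltnS.
    by rewrite ltn_add2r.
  by case/eqP: ne; apply: val_inj.
move=> n hn; rewrite -[LHS]/(powser_mul _ _ _) /powser_mul big1 // => i _.
case: (ltnP i (powser_ord a)) => hi; first by rewrite la ?mul0r.
rewrite lb ?mulr0 // ltn_subLR; last by rewrite -ltnS.
by apply: leq_trans hn _; rewrite leq_add2r.
Qed.
Lemma powser_integral : GRing.integral_domain_axiom powser.
Proof.
move=> a b ab; apply: contrapT => /negP; rewrite negb_or => /andP[a0 b0].
have [e _] := powser_mul_lead a0 b0; move: e; rewrite ab => /esym/eqP.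
by rewrite mulf_eq0 (negbTE (powser_ordP a0).1) (negbTE (powser_ordP b0).1).
Qed.
HB.instance Definition _ := GRing.ComUnitRing_isIntegral.Build powser powser_integral.

Lemma powser_ordM a b : a != 0 -> b != 0 ->
  powser_ord (a * b) = (powser_ord a + powser_ord b)%N.
Proof.
move=> a0 b0; have [e l] := powser_mul_lead a0 b0; apply: powser_ord_uniq => //.
by rewrite e mulf_neq0 ?(powser_ordP a0).1 ?(powser_ordP b0).1.
Qed.
Lemma powser_ordD a b : a != 0 -> b != 0 -> a + b != 0 ->
  (minn (powser_ord a) (powser_ord b) <= powser_ord (a + b)%R)%N.
Proof.
move=> a0 b0 ab0; rewrite leqNgt; apply/negP; rewrite leq_min => /andP[ha hb].
have [/eqP h _] := powser_ordP ab0; apply: h; rewrite -[LHS]/(_ + _).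
by rewrite (powser_ordP a0).2 // (powser_ordP b0).2 // addr0.
Qed.
Lemma powser_ord_const x : powser_ord (powser_const x) = 0%N.
Proof.
have [->|x0] := eqVneq x 0; last exact: powser_ord_uniq.
rewrite /powser_ord; case: pselect => // ex.
by case: ex_minnP => -[|n] /=; rewrite eqxx.
Qed.
End PowerSeries.

(* The field of Laurent series k((t)), as the fraction field of k[[t]]. *)
Section Laurent.
Variable k : fieldType.
Definition laurent : Type := {fraction (powser k)}.
HB.instance Definition _ := GRing.Field.on laurent.

Definition laurent_of (a : powser k) : laurent := FracField.tofrac a.
HB.instance Definition _ := GRing.RMorphism.copy laurent_of (@FracField.tofrac (powser k)).
Definition laurent_const (x : k) : laurent := laurent_of (powser_const x).
HB.instance Definition _ := GRing.RMorphism.copy laurent_const (laurent_of \o @powser_const k).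

Let lscale (x : k) (z : laurent) : laurent := laurent_const x * z.
Let lscaleA x y z : lscale x (lscale y z) = lscale (x * y) z.
Proof. by rewrite /lscale rmorphM mulrA. Qed.
Let lscale1 : left_id 1 lscale.
Proof. by move=> z; rewrite /lscale rmorph1 mul1r. Qed.
Let lscaleDr : right_distributive lscale +%R.
Proof. by move=> x y z; rewrite /lscale mulrDr. Qed.
Let lscaleDl z : {morph lscale^~ z : x y / x + y}.
Proof. by move=> x y; rewrite /lscale rmorphD mulrDl. Qed.
HB.instance Definition _ := GRing.Zmodule_isLmodule.Build k laurent
  lscaleA lscale1 lscaleDr lscaleDl.
Let lscaleAl (x : k) (u v : laurent) : x *: (u * v) = (x *: u) * v.
Proof. exact: mulrA. Qed.
HB.instance Definition _ := GRing.Lmodule_isLalgebra.Build k laurent lscaleAl.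
HB.instance Definition _ := GRing.Lalgebra_isComAlgebra.Build k laurent.
End Laurent.

(* Valuations of a k-algebra B, i : k -> B being the constants.  The value
   +oo is allowed at nonzero elements (if B is a field it never occurs there:
   v f + v f^-1 = v 1 = 0), and valuations are trivial on k. *)
Definition is_valuation (R : realType) (k : nzRingType) (B : pzRingType)
    (i : k -> B) (v : B -> \bar R) : Prop :=
  [/\ forall f, v f != -oo%E,
      v 0 = +oo%E,
      forall c, c != 0 -> v (i c) = 0%E,
      forall f g, v (f * g) = (v f + v g)%E &
      forall f g, (mine (v f) (v g) <= v (f + g)%R)%E].

Section OrdT.
Variables (R : realType) (k : fieldType).
Local Open Scope quotient_scope.
Implicit Types z w : laurent k.

(* ord_t, computed on any fraction representing the Laurent series *)
Definition ordt z : \bar R :=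
  if z == 0 then +oo%E
  else ((powser_ord (repr (z : {fraction (powser k)})).1)%:R
        - (powser_ord (repr (z : {fraction (powser k)})).2)%:R)%:E.

Lemma laurentE z :
  z = laurent_of (repr (z : {fraction (powser k)})).1
      / laurent_of (repr (z : {fraction (powser k)})).2.
Proof.
set r := repr _; have d0 : laurent_of r.2 != 0.
  by rewrite /laurent_of tofrac_eq0 denom_ratioP.
apply: (mulIf d0); rewrite divfK //.
have -> : z = \pi_({fraction (powser k)}) r by rewrite reprK.
rewrite /laurent_of; unlock FracField.tofrac.
rewrite -[LHS]FracField.pi_mul; apply/eqmodP; rewrite /= FracField.equivfE.
rewrite /FracField.mulf !numden_Ratio ?oner_eq0 ?mulr1 ?denom_ratioP //.
by rewrite mulrC.
Qed.

Lemma laurent_of_eq0 (a : powser k) : (laurent_of a == 0) = (a == 0).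
Proof. exact: tofrac_eq0. Qed.

Lemma ordt_div (a b : powser k) : a != 0 -> b != 0 ->
  ordt (laurent_of a / laurent_of b) = ((powser_ord a)%:R - (powser_ord b)%:R)%:E.
Proof.
move=> a0 b0; set z := _ / _; have z0 : z != 0.
  by rewrite mulf_neq0 ?invr_neq0 ?laurent_of_eq0.
have := laurentE z; rewrite /ordt (negbTE z0); set r := repr _ => zE.
have r20 : r.2 != 0 by exact: denom_ratioP.
have r10 : r.1 != 0.
  by apply: contraNneq z0 => r10; rewrite zE r10 rmorph0 mul0r.
have /eqP : a * r.2 = r.1 * b.
  apply/eqP; rewrite -subr_eq0 -laurent_of_eq0 rmorphB !rmorphM subr_eq0.
  by rewrite -eqr_div ?laurent_of_eq0 // -zE.
move=> /eqP/(congr1 (@powser_ord k)); rewrite !powser_ordM // => e.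
congr (_%:E); apply/eqP; rewrite subr_eq addrAC eq_sym subr_eq -!natrD.
by rewrite e.
Qed.

Lemma laurentP z : z != 0 -> exists a b : powser k,
  [/\ a != 0, b != 0 & z = laurent_of a / laurent_of b].
Proof.
move=> z0; have zE := laurentE z; do 2![eexists]; split; last exact: zE.
  by apply: contraNneq z0 => r10; rewrite zE r10 rmorph0 mul0r.
exact: denom_ratioP.
Qed.

Lemma ordt_valuation : is_valuation (@laurent_const k) ordt.
Proof.
have ordt0 : ordt 0 = +oo%E by rewrite /ordt eqxx.
have ordtNy z : ordt z != -oo%E by rewrite /ordt; case: ifP.
split=> //.
- move=> c c0; have -> : 0%E = ((powser_ord (powser_const c))%:R
      - (@powser_ord k 1)%:R)%:E :> \bar R.
    by rewrite (powser_ord_const 1) powser_ord_const subrr.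
  rewrite -ordt_div ?oner_eq0 // ?rmorph1 ?divr1 //.
  by rewrite fmorph_eq0.
- move=> z w; have [->|z0] := eqVneq z 0.
    by rewrite mul0r ordt0 addye.
  have [->|w0] := eqVneq w 0; first by rewrite mulr0 ordt0 addey.
  have [a [b [a0 b0 ->]]] := laurentP z0; have [c [d [c0 d0 ->]]] := laurentP w0.
  rewrite mulf_div -!rmorphM !ordt_div ?mulf_neq0 // -EFinD !powser_ordM //.
  by congr (_%:E); rewrite !natrD opprD addrACA.
- move=> z w; have [->|z0] := eqVneq z 0.
    by rewrite add0r ordt0 ge_min lexx orbT.
  have [->|w0] := eqVneq w 0; first by rewrite addr0 ordt0 ge_min lexx.
  have [->|zw0] := eqVneq (z + w) 0; first by rewrite ordt0 leey.
  move: z0 w0 zw0 => /laurentP[a [b [a0 b0 ->]]] /laurentP[c [d [c0 d0 ->]]].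
  rewrite addf_div ?laurent_of_eq0 // -!rmorphM -rmorphD => zw0.
  have n0 : a * d + c * b != 0.
    by apply: contraNneq zw0 => ->; rewrite rmorph0 mul0r.
  have := powser_ordD (mulf_neq0 a0 d0) (mulf_neq0 c0 b0) n0.
  rewrite !ordt_div ?mulf_neq0 // -EFin_min lee_fin !powser_ordM //.
  rewrite geq_min => h; rewrite ge_min !lerBlDr !natrD.
  case/orP: h => h; apply/orP; [left|right];
    rewrite -(ler_nat R) natrD in h; lra.
Qed.
End OrdT.

Section Tensor.
Variables (k : fieldType) (A B : comAlgType k).
Local Open Scope quotient_scope.

(* A formal sum of elementary tensors is a list of pairs; two such sums are
   equal in A (x) B when every k-bilinear map takes the same value on them. *)
Definition tens_sum (V : lmodType k) (b : A -> B -> V) (s : seq (A * B)) : V :=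
  \sum_(u <- s) b u.1 u.2.
Definition tens_eq : rel (seq (A * B)) := fun s t =>
  `[< forall (V : lmodType k) (b : A -> B -> V),
        bilinear_for *:%R *:%R b -> tens_sum b s = tens_sum b t >].
Lemma tens_eq_refl : reflexive tens_eq.
Proof. by move=> s; apply/asboolP. Qed.
Lemma tens_eq_sym : ssrbool.symmetric tens_eq.
Proof.
by move=> s t; apply/asboolP/asboolP => h V b hb; rewrite h.
Qed.
Lemma tens_eq_trans : transitive tens_eq.
Proof.
move=> t s r /asboolP st /asboolP tr; apply/asboolP => V b hb.
by rewrite st // tr.
Qed.
Canonical tens_eq_equiv := EquivRel tens_eq tens_eq_refl tens_eq_sym tens_eq_trans.
Definition tensor : Type := {eq_quot tens_eq}.
HB.instance Definition _ : EqQuotient _ tens_eq tensor := EqQuotient.on tensor.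
HB.instance Definition _ := Choice.on tensor.
Implicit Types x y z : tensor.

Definition tens (a : A) (c : B) : tensor := \pi_tensor [:: (a, c)].
Definition tens_lift (V : lmodType k) (b : A -> B -> V) x : V := tens_sum b (repr x).

Lemma tens_lift_pi (V : lmodType k) (b : A -> B -> V) s :
  bilinear_for *:%R *:%R b -> tens_lift b (\pi_tensor s) = tens_sum b s.
Proof.
move=> hb; have /eqmodP : repr (\pi_tensor s) = s %[mod tensor] by rewrite reprK.
by move=> /asboolP /(_ V b hb).
Qed.
Lemma tens_ext x y : (forall (V : lmodType k) (b : A -> B -> V),
  bilinear_for *:%R *:%R b -> tens_lift b x = tens_lift b y) -> x = y.
Proof.
by move=> h; rewrite -[x]reprK -[y]reprK; apply/eqmodP/asboolP.
Qed.

Definition tens_add x y : tensor := \pi_tensor (repr x ++ repr y).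
Definition tens_opp x : tensor := \pi_tensor [seq (- u.1, u.2) | u <- repr x].
Definition tens_mul x y : tensor :=
  \pi_tensor [seq (u.1 * w.1, u.2 * w.2) | u <- repr x, w <- repr y].

Section Lift.
Variables (V : lmodType k) (b : A -> B -> V).
Hypothesis hb : bilinear_for *:%R *:%R b.
Lemma bil0l c : b 0 c = 0.
Proof. by have /= := hb.1 c (-1) 0 0; rewrite !scaleN1r oppr0 addr0 addNr. Qed.
Lemma bilNl a c : b (- a) c = - b a c.
Proof. by have /= := hb.1 c (-1) a 0; rewrite !scaleN1r bil0l !addr0. Qed.
Lemma tens_lift0 : tens_lift b (\pi_tensor [::]) = 0.
Proof. by rewrite tens_lift_pi // /tens_sum big_nil. Qed.
Lemma tens_lift_tens a c : tens_lift b (tens a c) = b a c.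
Proof. by rewrite tens_lift_pi // /tens_sum big_seq1. Qed.
Lemma tens_liftD x y : tens_lift b (tens_add x y) = tens_lift b x + tens_lift b y.
Proof. by rewrite tens_lift_pi // /tens_sum big_cat. Qed.
Lemma tens_liftN x : tens_lift b (tens_opp x) = - tens_lift b x.
Proof.
rewrite tens_lift_pi // /tens_sum big_map -sumrN.
by apply: eq_bigr => u _; rewrite bilNl.
Qed.
Lemma tens_liftM x y : tens_lift b (tens_mul x y) =
  tens_lift (fun a c => tens_lift (fun a' c' => b (a * a') (c * c')) y) x.
Proof. by rewrite tens_lift_pi // /tens_sum big_allpairs_dep. Qed.
Lemma bilM a c : bilinear_for *:%R *:%R (fun a' c' => b (a * a') (c * c')).
Proof.
by split=> [c' s u v|a' s u v]; rewrite mulrDr -scalerAr ?hb.1 ?hb.2.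
Qed.
Lemma bil_liftM y : bilinear_for *:%R *:%R
  (fun a c => tens_lift (fun a' c' => b (a * a') (c * c')) y).
Proof.
split=> [c s u v|a s u v]; rewrite /tens_lift /tens_sum /= scaler_sumr -big_split /=;
  by apply: eq_bigr => w _; rewrite mulrDl -scalerAl ?hb.1 ?hb.2.
Qed.
End Lift.

Lemma eq_tens_lift (V : lmodType k) (b b' : A -> B -> V) x :
  b =2 b' -> tens_lift b x = tens_lift b' x.
Proof. by move=> e; apply: eq_bigr => u _; rewrite e. Qed.

Lemma tens_addA : associative tens_add.
Proof. by move=> x y z; apply: tens_ext => V b hb; rewrite !tens_liftD // addrA. Qed.
Lemma tens_addC : commutative tens_add.
Proof. by move=> x y; apply: tens_ext => V b hb; rewrite !tens_liftD // addrC. Qed.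
Lemma tens_add0 : left_id (\pi_tensor [::]) tens_add.
Proof.
by move=> x; apply: tens_ext => V b hb; rewrite tens_liftD // tens_lift0 // add0r.
Qed.
Lemma tens_addN : left_inverse (\pi_tensor [::]) tens_opp tens_add.
Proof.
move=> x; apply: tens_ext => V b hb.
by rewrite tens_liftD // tens_liftN // tens_lift0 // addNr.
Qed.
HB.instance Definition _ := GRing.isZmodule.Build tensor
  tens_addA tens_addC tens_add0 tens_addN.

Lemma tens_mulC : commutative tens_mul.
Proof.
move=> x y; apply: tens_ext => V b hb; rewrite !tens_liftM //.
rewrite /tens_lift /tens_sum exchange_big; apply: eq_bigr => u _.
by apply: eq_bigr => w _; rewrite mulrC [u.2 * _]mulrC.
Qed.
Lemma tens_mulA : associative tens_mul.
Proof.
move=> x y z; apply: tens_ext => V b hb; rewrite !tens_liftM //; last exact: bil_liftM.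
apply: eq_tens_lift => a c; rewrite tens_liftM; last exact: bilM.
by do 2![apply: eq_tens_lift => ? ?]; rewrite !mulrA.
Qed.
Lemma tens_mul1 : left_id (tens 1 1) tens_mul.
Proof.
move=> x; apply: tens_ext => V b hb; rewrite tens_liftM // tens_lift_tens.
  by apply: eq_tens_lift => a c; rewrite !mul1r.
exact: bil_liftM.
Qed.
Lemma tens_mulDl : left_distributive tens_mul +%R.
Proof.
move=> x y z; apply: tens_ext => V b hb.
by rewrite tens_liftM // !tens_liftD ?tens_liftM //; exact: bil_liftM.
Qed.
HB.instance Definition _ := GRing.Zmodule_isComPzRing.Build tensor
  tens_mulA tens_mulC tens_mul1 tens_mulDl.
End Tensor.

(* Zariski topology and regular functions on a set T, relative to a map
   c : T -> k^N giving coordinates. *)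
Section Zariski.
Variables (k : fieldType) (N : nat) (T : Type) (c : T -> 'rV[k]_N).
Definition peval M (P : mpoly M k) (x : 'rV[k]_M) : k := meval (x ord0) P.
Definition zlocus (S : set (mpoly N k)) : set T :=
  [set x | forall P, S P -> peval P (c x) = 0].
Definition zclosed (V : set T) := exists S, V = zlocus S.
Definition zopen (U : set T) := zclosed (~` U).
Definition zdense (D : set T) := forall V, zclosed V -> D `<=` V -> V = setT.
Definition zirreducible (D : set T) := D !=set0 /\
  forall V W, zclosed V -> zclosed W -> D `<=` V `|` W -> D `<=` V \/ D `<=` W.
Definition zconnected (D : set T) := D !=set0 /\
  forall V W, zclosed V -> zclosed W -> D `<=` V `|` W ->
    D `&` V `&` W = set0 -> D `<=` V \/ D `<=` W.
Definition zregular (f : T -> k) :=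
  exists P : mpoly N k, forall x, f x = peval P (c x).
End Zariski.
Arguments zclosed {k N T} c V.
Arguments zopen {k N T} c U.
Arguments zdense {k N T} c D.
Arguments zirreducible {k N T} c D.
Arguments zconnected {k N T} c D.
Arguments zregular {k N T} c f.

Lemma peval_comp (k : fieldType) (N M : nat) (T : Type) (c : T -> 'rV[k]_N)
    (d : T -> 'rV[k]_M) (f : T -> k) :
  (forall i, zregular c (fun x => d x ord0 i)) -> zregular d f -> zregular c f.
Proof.
move=> /choice[Q hQ] [P hP].
exists (comp_mpoly [tuple Q i | i < M] P) => x.
rewrite hP /peval comp_mpoly_meval; apply: meval_eq => i.
by rewrite tnth_mktuple hQ.
Qed.

(* Nonempty closed subsets of affine space k^n; not assumed irreducible. *)
Record affineSet (k : fieldType) (n : nat) := AffineSet {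
  afset :> set 'rV[k]_n;
  afset_closed : zclosed id afset;
  afset_neq0 : afset !=set0 }.

Definition pt (k : fieldType) (n : nat) (X : affineSet k n) (x : X) : 'rV[k]_n := \val x.

Section CoordinateRing.
Variables (k : fieldType) (n : nat) (X : affineSet k n).

Definition coord_pred : pred (X -> k) :=
  fun f => `[< zregular (@pt k n X) f >].
Record coordRing : Type := Coord { coord_fun :> X -> k; coord_regular : coord_pred coord_fun }.
HB.instance Definition _ := [isSub for coord_fun].
HB.instance Definition _ := [Choice of coordRing by <:].

Lemma coord_subring : subring_closed coord_pred.
Proof.
split=> [|f g /asboolP[P hP] /asboolP[Q hQ]|f g /asboolP[P hP] /asboolP[Q hQ]];
  apply/asboolP.
- by exists 1 => x; rewrite /peval meval1.
- by exists (P - Q) => x; rewrite /peval mevalB -!/(peval _ _) -hP -hQ.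
- by exists (P * Q) => x; rewrite /peval mevalM -!/(peval _ _) -hP -hQ.
Qed.
HB.instance Definition _ :=
  GRing.SubChoice_isSubComPzRing.Build (X -> k) coord_pred coordRing coord_subring.

Lemma coordD (f g : coordRing) x : (f + g) x = f x + g x. Proof. by []. Qed.
Lemma coordM (f g : coordRing) x : (f * g) x = f x * g x. Proof. by []. Qed.
Lemma coord_one x : (1 : coordRing) x = 1. Proof. by []. Qed.
Lemma coord_zero x : (0 : coordRing) x = 0. Proof. by []. Qed.
Lemma coordP (f g : coordRing) : f =1 g -> f = g.
Proof. by move=> fg; apply: val_inj; apply/funext. Qed.

Lemma coord_1_neq0 : 1 != 0 :> coordRing.
Proof.
have [x Xx] := afset_neq0 X; apply/eqP => /(congr1 (fun f : coordRing => f (SigSub (mem_set Xx)))).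
by move/eqP; rewrite coord_one coord_zero oner_eq0.
Qed.
HB.instance Definition _ := GRing.PzSemiRing_isNonZero.Build coordRing coord_1_neq0.

Lemma coord_scale_subproof (a : k) (f : coordRing) : coord_pred (fun x => a * f x).
Proof.
have /asboolP[P hP] := coord_regular f; apply/asboolP; exists (a *: P) => x.
by rewrite /peval mevalZ hP.
Qed.
Definition coord_scale a f : coordRing := Coord (coord_scale_subproof a f).
Lemma coord_scaleA a b f : coord_scale a (coord_scale b f) = coord_scale (a * b) f.
Proof. by apply: coordP => x /=; rewrite mulrA. Qed.
Lemma coord_scale1 : left_id 1 coord_scale.
Proof. by move=> f; apply: coordP => x /=; rewrite mul1r. Qed.
Lemma coord_scaleDr : right_distributive coord_scale +%R.
Proof. by move=> a f g; apply: coordP => x; exact: mulrDr. Qed.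
Lemma coord_scaleDl f : {morph coord_scale^~ f : a b / a + b}.
Proof. by move=> a b; apply: coordP => x; exact: mulrDl. Qed.
HB.instance Definition _ := GRing.Zmodule_isLmodule.Build k coordRing
  coord_scaleA coord_scale1 coord_scaleDr coord_scaleDl.
Lemma coord_scaleAl (a : k) (f g : coordRing) : a *: (f * g) = (a *: f) * g.
Proof. by apply: coordP => x; exact: mulrA. Qed.
HB.instance Definition _ := GRing.Lmodule_isLalgebra.Build k coordRing coord_scaleAl.
HB.instance Definition _ := GRing.Lalgebra_isComAlgebra.Build k coordRing.
End CoordinateRing.

(* irreducible Zariski-closed subsets of k^n *)
Record affineVariety (k : fieldType) (n : nat) := AffineVariety {
  avset :> affineSet k n;
  av_irreducible : zirreducible (@pt k n avset) setT }.

Section FunctionField.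
Variables (k : fieldType) (n : nat) (X : affineVariety k n).
Local Notation A := (coordRing X).

Lemma coord_integral : GRing.integral_domain_axiom A.
Proof.
move=> f g fg; have [_ irr] := av_irreducible X.
have vcl (h : A) : zclosed (@pt k n X) [set x | h x = 0].
  have /asboolP[P hP] := coord_regular h; exists [set P].
  apply/seteqP; split=> x /=; first by move=> hx Q ->; rewrite -hP.
  by move=> /(_ P erefl); rewrite -hP.
have fg0 : [set: X] `<=` [set x | f x = 0] `|` [set x | g x = 0].
  move=> x _ /=; have /eqP : f x * g x = 0 by rewrite -coordM fg.
  by rewrite mulf_eq0 => /orP[]/eqP; [left|right].
by have [h|h] := irr _ _ (vcl f) (vcl g) fg0; apply/orP; [left|right];
  apply/eqP; apply: coordP => x; exact: h.
Qed.
HB.instance Definition _ := GRing.ComNzRing_hasMulInverse.Build A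
  (@cunit_mulVr A) (@cunitPl A) (@cinv_out A).
HB.instance Definition _ := GRing.ComUnitRing_isIntegral.Build A coord_integral.
Definition funfield : Type := {fraction A}.
HB.instance Definition _ := GRing.Field.on funfield.
Definition funfield_of (f : A) : funfield := FracField.tofrac f.
HB.instance Definition _ := GRing.RMorphism.copy funfield_of (@FracField.tofrac A).
End FunctionField.

Section LinearGroups.
Variables (k : fieldType) (m : nat).

(* Coordinates on GL_m: the matrix entries and the inverse determinant. *)
Definition gl_coord (g : 'M[k]_m) : 'rV[k]_(m * m + 1) :=
  row_mx (mxvec g) (const_mx (\det g)^-1).

(* Linear algebraic groups: Zariski-closed subgroups of GL_m. *)
Record linAlgGroup := LinAlgGroup {
  lag :> set 'M[k]_m;
  lag_unit : lag `<=` [set g | g \in unitmx];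
  lag_closed : exists S, lag = [set g | g \in unitmx] `&` zlocus gl_coord S;
  lag1 : lag 1%:M;
  lagM : forall g h, lag g -> lag h -> lag (g *m h);
  lagV : forall g, lag g -> lag (invmx g) }.

Variable G : linAlgGroup.
Record lgpt : Type := LgPt { lgmx :> 'M[k]_m; lgmxP : lgmx \in (G : set _) }.
HB.instance Definition _ := [isSub for lgmx].
HB.instance Definition _ := [Choice of lgpt by <:].
Implicit Types g h : lgpt.

Definition lg_one : lgpt := LgPt (mem_set (lag1 G)).
Definition lg_mul g h : lgpt :=
  LgPt (mem_set (lagM (set_mem (lgmxP g)) (set_mem (lgmxP h)))).
Definition lg_inv g : lgpt := LgPt (mem_set (lagV (set_mem (lgmxP g)))).
Lemma lg_unit g : lgmx g \in unitmx.
Proof. exact: (lag_unit (set_mem (lgmxP g))). Qed.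
Lemma lg_mulA : associative lg_mul.
Proof. by move=> g h l; apply: val_inj; rewrite /= mulmxA. Qed.
Lemma lg_mul1 : left_id lg_one lg_mul.
Proof. by move=> g; apply: val_inj; rewrite /= mul1mx. Qed.
Lemma lg_mulr1 : right_id lg_one lg_mul.
Proof. by move=> g; apply: val_inj; rewrite /= mulmx1. Qed.
Lemma lg_mulV : left_inverse lg_one lg_inv lg_mul.
Proof. by move=> g; apply: val_inj; rewrite /= mulVmx ?lg_unit. Qed.
Lemma lg_mulrV : right_inverse lg_one lg_inv lg_mul.
Proof. by move=> g; apply: val_inj; rewrite /= mulmxV ?lg_unit. Qed.
HB.instance Definition _ := isGroup.Build lgpt
  lg_mulA lg_mul1 lg_mulr1 lg_mulV lg_mulrV.

Definition lg_coord g : 'rV[k]_(m * m + 1) := gl_coord g.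

Local Open Scope group_scope.
Definition is_subgroup (H : set lgpt) : Prop :=
  [/\ H 1, forall g h, H g -> H h -> H (g * h) & forall g, H g -> H g^-1].
Definition is_normal (H : set lgpt) : Prop :=
  forall g h, H h -> H (g * h * g^-1).
Definition derived_subgroup (H : set lgpt) : set lgpt :=
  smallest is_subgroup [set x | exists g h, [/\ H g, H h & x = [~ g, h]]].
Definition is_solvable (H : set lgpt) : Prop :=
  exists i, iter i derived_subgroup H = [set 1].
Definition is_unipotent (H : set lgpt) : Prop :=
  forall h, H h -> exists i, (((h : 'M[k]_m) - 1%:M) ^+ i = 0)%R.

Definition connected_closed_subgroup (H : set lgpt) : Prop :=
  [/\ is_subgroup H, zclosed lg_coord H & zconnected lg_coord H].
Definition is_connected : Prop := zconnected lg_coord [set: lgpt].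
(* trivial unipotent radical *)
Definition is_reductive : Prop := forall H : set lgpt,
  connected_closed_subgroup H -> is_normal H -> is_unipotent H -> H = [set 1].
Definition is_borel (B : set lgpt) : Prop :=
  [/\ connected_closed_subgroup B, is_solvable B &
      forall H, connected_closed_subgroup H -> is_solvable H -> B `<=` H -> H = B].

Definition generically (Q : lgpt -> Prop) : Prop :=
  exists U, [/\ zopen lg_coord U, U !=set0 & forall g, U g -> Q g].
End LinearGroups.
Arguments lg_coord {k m G} g.

Section Actions.
Variables (k : fieldType) (m n : nat) (G : linAlgGroup k m).
Variable X : affineVariety k n.

(* Algebraic actions: in coordinates, (g, x) |-> g x is given by polynomials in
   the coordinates of x, the entries of g and 1 / det g. *)
Record action := Action {
  act :> lgpt G -> X -> X;
  act1 : forall x, act 1%g x = x;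
  actM : forall g h x, act (g * h)%g x = act g (act h x);
  act_regular : forall i : 'I_n,
    zregular (fun gx : lgpt G * X => row_mx (lg_coord gx.1) (pt gx.2))
             (fun gx => pt (act gx.1 gx.2) ord0 i) }.

Variable a : action.

Definition actOrbit (H : set (lgpt G)) (x : X) : set X := [set a h x | h in H].
Definition is_spherical : Prop := exists B x,
  [/\ is_borel B, zopen (@pt k n X) (actOrbit B x) & zdense (@pt k n X) (actOrbit B x)].
(* X being irreducible, there is at most one open orbit *)
Definition in_open_orbit (x : X) : Prop := zopen (@pt k n X) (actOrbit setT x).

Lemma translate_regular (g : lgpt G) (f : coordRing X) : coord_pred (f \o a g^-1%g).
Proof.
apply/asboolP; apply: (peval_comp (d := @pt k n X \o a g^-1%g)).
  move=> i /=; have [P hP] := act_regular a i.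
  pose c x := row_mx (lg_coord g^-1%g) (@pt k n X x).
  have hc : zregular c (fun x => pt (a g^-1%g x) ord0 i).
    by exists P => x; rewrite -(hP (g^-1%g, x)).
  apply: peval_comp hc => j; rewrite /c.
  case: (split_ordP j) => l ->.
    by exists (mpolyC _ (lg_coord g^-1%g ord0 l)) => x; rewrite row_mxEl /peval mevalC.
  by exists (mpolyX _ (mnm1 l)) => x; rewrite row_mxEr /peval mevalXU.
by have /asboolP[P hP] := coord_regular f; exists P => x /=; rewrite hP.
Qed.
(* (g . f) (x) = f (g^-1 x) *)
Definition translate (g : lgpt G) (f : coordRing X) : coordRing X := Coord (translate_regular g f).

(* G-invariant valuations of k[X], with values in R u {+oo} and +oo allowed at
   nonzero functions.  Those finite on nonzero functions are the restrictions of
   the G-invariant valuations of k(X); the others are needed because the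
   tropicalization of a point of Y^an supported outside the open orbit takes
   the value +oo on some f <> 0.  The topology is the coarsest one for which
   all evaluations v |-> v f are continuous. *)
Variable R : realType.
Record invValuation := InvValuation {
  inv_val :> coordRing X -> \bar R;
  inv_val_valuation : is_valuation (in_alg (coordRing X)) inv_val;
  inv_val_inv : forall g f, inv_val (translate g f) = inv_val f }.
HB.instance Definition _ := gen_eqMixin invValuation.
HB.instance Definition _ := gen_choiceMixin invValuation.
HB.instance Definition _ := Topological.copy invValuation
  (initial_topology (fun v : invValuation => (v : {ptws coordRing X -> \bar R}))).

(* G-invariant valuations of the field k(X), on which G acts by
   g . (f1 / f2) = (g . f1) / (g . f2); then those with values in Q. *)
Definition inv_field_valuation : set (funfield X -> \bar R) :=
  [set w | is_valuation (fun c : k => funfield_of (in_alg (coordRing X) c)) w /\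
    forall g (f1 f2 : coordRing X),
      w (funfield_of (translate g f1) / funfield_of (translate g f2))
      = w (funfield_of f1 / funfield_of f2)].
Definition inv_field_valuation_rat : set (funfield X -> \bar R) :=
  inv_field_valuation `&`
  [set w | forall phi, phi != 0 -> exists q : rat, w phi = (ratr q)%:E].
End Actions.

Section TrivialValuation.
Variables (R : realType) (k : fieldType) (m n : nat) (G : linAlgGroup k m).
Variables (X : affineVariety k n) (a : action G X).

Definition triv_val (f : coordRing X) : \bar R := if f == 0 then +oo%E else 0%E.
Lemma triv_val_valuation : is_valuation (in_alg (coordRing X)) triv_val.
Proof.
rewrite /triv_val; split=> [f||c c0|f g|f g]; first by case: ifP.
- by rewrite eqxx.
- by rewrite scaler_eq0 oner_eq0 orbF (negbTE c0).
- by rewrite mulf_eq0; case: (f == 0); case: (g == 0); rewrite /= ?addr0.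
have [->|f0] := eqVneq f 0; first by rewrite add0r ge_min lexx orbT.
by case: (f + g == 0); rewrite ge_min ?leey ?lexx.
Qed.
Lemma triv_val_inv g (f : coordRing X) : triv_val (translate a g f) = triv_val f.
Proof.
rewrite /triv_val; congr (if _ then _ else _); apply/eqP/eqP => [h|->].
  apply: coordP => x; rewrite -[x](act1 a) -(mulVg g) actM.
  exact: (congr1 (fun f : coordRing X => f (a g x)) h).
exact: coordP.
Qed.
Definition triv_invValuation : invValuation a R :=
  InvValuation triv_val_valuation triv_val_inv.
End TrivialValuation.

Section Analytification.
Variables (R : realType) (k : fieldType) (n : nat) (Y : affineSet k n).
Local Notation K := (laurent k).

(* Y^an, with the coarsest topology for which all p |-> p F are continuous;
   p (1 (x) l) = exp (- ord_t l) includes p 0 = 0. *)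
Record analytification := Analytification {
  seminorm :> tensor (coordRing Y) K -> R;
  seminorm_ge0 : forall F, 0 <= seminorm F;
  seminormM : forall F H, seminorm (F * H) = seminorm F * seminorm H;
  seminorm_const : forall l : K, (seminorm (tens 1 l))%:E = expeR (- ordt R l);
  seminorm_ultra : forall F H,
    seminorm (F + H) <= Num.max (seminorm F) (seminorm H) }.
HB.instance Definition _ := gen_eqMixin analytification.
HB.instance Definition _ := gen_choiceMixin analytification.
HB.instance Definition _ := Topological.copy analytification
  (initial_topology (fun p : analytification => (p : {ptws tensor (coordRing Y) K -> R}))).

Definition seminorm_val (p : analytification) (f : coordRing Y) : \bar R :=
  (- lne (p (tens f 1))%:E)%E.

(* Y(K): the point gamma is identified with the map f |-> f(gamma) *)
Definition Kpoint : Type := {lrmorphism coordRing Y -> K}.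

Definition Kpoint_eval (gamma : Kpoint) : tensor (coordRing Y) K -> K :=
  tens_lift (fun f l => l * gamma f).
Definition Kpoint_seminorm (gamma : Kpoint) (F : tensor (coordRing Y) K) : R :=
  fine (expeR (- ordt R (Kpoint_eval gamma F))).

Section KpointProof.
Variable gamma : Kpoint.
Let bil : bilinear_for *:%R *:%R (fun (f : coordRing Y) (l : K) => l * gamma f).
Proof.
split=> [l c f f'|f c l l'] /=; first by rewrite linearP mulrDr scalerAr.
by rewrite mulrDl scalerAl.
Qed.
Lemma Kpoint_evalD F H :
  Kpoint_eval gamma (F + H) = Kpoint_eval gamma F + Kpoint_eval gamma H.
Proof. exact: tens_liftD. Qed.
Lemma Kpoint_eval_tens f l : Kpoint_eval gamma (tens f l) = l * gamma f.
Proof. exact: tens_lift_tens. Qed.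
Lemma Kpoint_evalM F H :
  Kpoint_eval gamma (F * H) = Kpoint_eval gamma F * Kpoint_eval gamma H.
Proof.
rewrite /Kpoint_eval [LHS]tens_liftM // /tens_lift /tens_sum big_distrl.
apply: eq_bigr => u _; rewrite big_distrr; apply: eq_bigr => w _ /=.
by rewrite rmorphM mulrACA.
Qed.
Let absE (z : K) : (fine (expeR (- ordt R z)))%:E = expeR (- ordt R z).
Proof. by case: (ordt_valuation R k) => /(_ z); case: (ordt R z). Qed.
Let sge0 F : 0 <= Kpoint_seminorm gamma F.
Proof. by rewrite -lee_fin absE expeR_ge0. Qed.
Let sM F H : Kpoint_seminorm gamma (F * H)
  = Kpoint_seminorm gamma F * Kpoint_seminorm gamma H.
Proof.
apply: EFin_inj; rewrite EFinM !absE Kpoint_evalM -expeRD.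
have [ny _ _ -> _] := ordt_valuation R k; congr expeR.
by rewrite oppeD //; have := ny (Kpoint_eval gamma F); have := ny (Kpoint_eval gamma H);
  do 2!case: (ordt R _).
Qed.
Let sconst (l : K) : (Kpoint_seminorm gamma (tens 1 l))%:E = expeR (- ordt R l).
Proof. by rewrite absE Kpoint_eval_tens rmorph1 mulr1. Qed.
Let sultra F H : Kpoint_seminorm gamma (F + H)
  <= Num.max (Kpoint_seminorm gamma F) (Kpoint_seminorm gamma H).
Proof.
rewrite -lee_fin EFin_max !absE Kpoint_evalD.
have [_ _ _ _ /(_ (Kpoint_eval gamma F) (Kpoint_eval gamma H))] := ordt_valuation R k.
by rewrite ge_min le_max !lee_expeR !leeN2.
Qed.
(* the embedding j : Y(K) -> Y^an *)
Definition Kpoint_an : analytification := Analytification sge0 sM sconst sultra.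
End KpointProof.
End Analytification.

Section Tropicalization.
Variables (R : realType) (k : fieldType) (m n : nat) (G : linAlgGroup k m).
Variables (X : affineVariety k n) (a : action G X) (Y : affineSet k n).
Variable YX : Y `<=` X.

Definition incl (y : Y) : X := SigSub (mem_set (YX (set_mem (valP y)))).
Lemma restr_regular (f : coordRing X) : coord_pred (f \o incl).
Proof.
by have /asboolP[P hP] := coord_regular f; apply/asboolP; exists P => y; rewrite /= hP.
Qed.
(* pi : k[X] -> k[Y] *)
Definition restr (f : coordRing X) : coordRing Y := Coord (restr_regular f).

(* w f = v (pi (g . f)) for g in a nonempty Zariski open U_f \subset G *)
Definition is_bar (v : coordRing Y -> \bar R) (w : coordRing X -> \bar R) : Prop :=
  forall f, generically (fun g => w f = v (restr (translate a g f))).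
(* The element of the target determined by is_bar; the default value of xget is
   only a placeholder, used if there is none. *)
Definition bar (v : coordRing Y -> \bar R) : invValuation a R :=
  xget (triv_invValuation R a) [set w : invValuation a R | is_bar v w].
Definition Trop_an (p : analytification R Y) : invValuation a R := bar (seminorm_val p).

(* f(g . gamma), for gamma in Y(K) \subset X(K): g . gamma is the K-point of X
   whose evaluation map is f |-> (g^-1 . f)(gamma). *)
Definition translate_eval (gamma : Kpoint Y) (g : lgpt G) (f : coordRing X) : laurent k :=
  gamma (restr (translate a g^-1%g f)).
Definition is_trop (gamma : Kpoint Y) (w : coordRing X -> \bar R) : Prop :=
  forall f, generically (fun g => w f = ordt R (translate_eval gamma g f)).
Definition Trop (gamma : Kpoint Y) : invValuation a R :=
  xget (triv_invValuation R a) [set w : invValuation a R | is_trop gamma w].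

Definition meets_open_orbit : Prop := exists y : Y, in_open_orbit a (incl y).
(* The center of p, resp. gamma, i.e. the subvariety of Y defined by the prime
   ideal of those f which p, resp. gamma, kills, meets the open orbit. *)
Definition in_open_orbit_an (p : analytification R Y) : Prop :=
  exists y : Y, in_open_orbit a (incl y) /\ forall f, p (tens f 1) = 0 -> f y = 0.
Definition in_open_orbit_K (gamma : Kpoint Y) : Prop :=
  exists y : Y, in_open_orbit a (incl y) /\ forall f, gamma f = 0 -> f y = 0.
End Tropicalization.

(* Main.v *)
Require Import Defs.
From HB Require Import structures.
From mathcomp Require Import all_boot all_order all_algebra.
From mathcomp Require Import all_classical all_reals all_analysis.
From mathcomp Require Import -(notations) mpoly.
From mathcomp Require Import lra.
Set Implicit Arguments.
Unset Strict Implicit.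
Unset Printing Implicit Defensive.
Import Order.TTheory GRing.Theory Num.Theory numFieldNormedType.Exports.
Local Open Scope classical_set_scope.
Local Open Scope ring_scope.

(** Write [pi (g f)] for [restr YX (translate a g f)], and let [v] be a
    valuation of k[Y].

    As the action is algebraic, [g |-> pi (g f)] takes its values in a
    finite-dimensional subspace of k[Y] and has regular coordinates
    ([translate_comb]).  Finitely many of these translates, say
    [pi (g_1 f), .., pi (g_s f)], span all the others.  The ultrametric inequality
    then makes the least value of [v] on them a lower bound of all
    [v (pi (g f))], and the elements of the subspace with larger valuation form
    a proper linear subspace, so that this least value is taken for generic [g]
    ([generic_val_restr]).  Hence
      [bar v f = min_j v (pi (g_j f))],
    where the [g_j] depend on [f] only and not on [v] ([bar_bigmin]).

    Everything follows from this formula.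
    - [bar v] is a [G]-invariant valuation ([exists_bar]): invariance and the
      ultrametric inequality hold because [bar v f] is the minimum of
      [v (pi (g f))] over all [g], and multiplicativity because three generic
      conditions on [g] can be met at once.  The latter is the irreducibility
      of the connected group [G] ([connected_open_meet]).
    - For fixed [f], [p |-> bar v_p f] is the opposite of the logarithm of a
      maximum of finitely many evaluations [p |-> p (pi (g_j f))], hence
      continuous, also where it is infinite ([Trop_an_continuous]).
    - If the center of [p] contains a point [y] of the open orbit, a function
      [f <> 0] cannot vanish on the whole orbit of [y], so that [bar v_p f] is
      finite ([bar_lty]); a valuation finite off 0 extends to k(X)
      ([invValuation_extend]).
    - On the side of Y(K), the valuation of [j gamma] is [ord_t \o gamma], and
      [Trop gamma] is its bar up to [g |-> g^-1], which preserves genericity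
      ([Trop_eq_bar]). *)

(** * Spanning families, regular functions and open sets *)

(** Any set of row vectors contains a finite spanning family: take one of
    largest rank. *)
Lemma exists_spanning_rows (k : fieldType) (r : nat) (T : set 'rV[k]_r) :
  exists (s : nat) (A : 'M[k]_(s, r)),
    (forall i, T (row i A)) /\ forall t, T t -> (t <= A)%MS.
Proof.
pose P d := `[< exists (s : nat) (A : 'M[k]_(s, r)),
                  (forall i, T (row i A)) /\ \rank A = d >].
have exP : exists d, P d.
  exists 0%N; apply/asboolP; exists 0%N, 0; split=> [[]//|].
  by rewrite mxrank0.
have ubP d : P d -> (d <= r)%N by move=> /asboolP[s [A [_ <-]]]; exact: rank_leq_col.
case: (ex_maxnP exP ubP) => d /asboolP[s [A [TA rA]]] maxd.
exists s, A; split=> // t Tt.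
have : (\rank (col_mx t A) <= d)%N.
  apply: maxd; apply/asboolP; exists (1 + s)%N, (col_mx t A); split=> // i.
  case: (split_ordP i) => j ->; last by rewrite rowKd.
  by rewrite rowKu (ord1 j) (_ : row 0 t = t) //; apply/rowP => l; rewrite mxE.
rewrite -rA => le; have subA : (A <= col_mx t A)%MS.
  by rewrite -addsmxE addsmxSr.
have := mxrank_leqif_sup subA => /leqifP; rewrite (leq_gtF le).
by case: ifP => // h _; move: h; rewrite col_mx_sub => /andP[].
Qed.

(** A linear subspace given only by a predicate is the row space of some matrix,
    and a column of the cokernel of that matrix separates [x] from it. *)
Lemma separating_functional (k : fieldType) (r : nat) (S : set 'rV[k]_r) (x : 'rV[k]_r) :
  S 0 -> (forall c u w, S u -> S w -> S (c *: u + w)) -> ~ S x ->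
  exists l : 'cV[k]_r, (forall u, S u -> (u *m l) 0 0 = 0) /\ (x *m l) 0 0 != 0.
Proof.
move=> S0 Slin Sx; have [s [A [SA spanA]]] := exists_spanning_rows S.
have nxA : ~~ (x <= A)%MS.
  apply/negP => /submxP[D xD]; apply: Sx; rewrite xD mulmx_sum_row.
  by elim/big_rec: _ => // i u _ Su; exact: Slin.
rewrite submxE in nxA; have /rV0Pn[j nj] := nxA.
exists (col j (cokermx A)); split=> [u /spanA|].
  by rewrite submxE colE mulmxA => /eqP->; rewrite mul0mx mxE.
by rewrite colE mulmxA -colE mxE.
Qed.

Section Regular.
Variables (k : fieldType) (N : nat) (T : Type) (c : T -> 'rV[k]_N).
Implicit Types f g : T -> k.

Lemma zregular_ext f g : f =1 g -> zregular c f -> zregular c g.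
Proof. by move=> fg [P hP]; exists P => x; rewrite -fg. Qed.

Lemma zregular_cst a : zregular c (fun=> a).
Proof. by exists (mpolyC N a) => x; rewrite /peval mevalC. Qed.

Lemma zregular_coord i : zregular c (fun x => c x 0 i).
Proof. by exists (mpolyX k (mnm1 i)) => x; rewrite /peval mevalXU. Qed.

Lemma zregularD f g : zregular c f -> zregular c g -> zregular c (fun x => f x + g x).
Proof. by move=> [P hP] [Q hQ]; exists (P + Q) => x; rewrite /peval mevalD hP hQ. Qed.

Lemma zregularM f g : zregular c f -> zregular c g -> zregular c (fun x => f x * g x).
Proof. by move=> [P hP] [Q hQ]; exists (P * Q) => x; rewrite /peval mevalM hP hQ. Qed.

Lemma zregularX f i : zregular c f -> zregular c (fun x => f x ^+ i).
Proof.
move=> fr; elim: i => [|i IH]; first exact: zregular_cst.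
by apply: zregular_ext (zregularM fr IH) => x; rewrite exprS.
Qed.

Lemma zregular_sum (I : finType) (F : I -> T -> k) :
  (forall i, zregular c (F i)) -> zregular c (fun x => \sum_i F i x).
Proof.
move=> Fr; elim: (index_enum I) => [|i s IH].
  by apply: zregular_ext (zregular_cst 0) => x; rewrite big_nil.
by apply: zregular_ext (zregularD (Fr i) IH) => x; rewrite big_cons.
Qed.

Lemma zregular_prod (I : finType) (F : I -> T -> k) :
  (forall i, zregular c (F i)) -> zregular c (fun x => \prod_i F i x).
Proof.
move=> Fr; elim: (index_enum I) => [|i s IH].
  by apply: zregular_ext (zregular_cst 1) => x; rewrite big_nil.
by apply: zregular_ext (zregularM (Fr i) IH) => x; rewrite big_cons.
Qed.

Lemma zregular_det q (M : T -> 'M[k]_q) :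
  (forall i j, zregular c (fun x => M x i j)) -> zregular c (fun x => \det (M x)).
Proof.
move=> Mr; apply: zregular_sum => s.
by apply: zregularM; [exact: zregular_cst | exact: zregular_prod].
Qed.

(** The sets where a regular function does not vanish form a basis of the Zariski
    topology; unlike the definition by equations, this makes intersections and
    preimages immediate. *)
Lemma zopenP (U : set T) :
  zopen c U <-> forall x, U x -> exists f,
    [/\ zregular c f, f x != 0 & forall y, f y != 0 -> U y].
Proof.
split=> [[S US] x Ux|loc].
  have : ~ (~` U) x by [].
  rewrite US => /existsNP[P /not_implyP[SP /eqP nP]].
  exists (fun y => peval P (c y)); split=> //; first by exists P.
  move=> y nPy; apply: contrapT => nUy; move: (nUy); rewrite -[~ U y]/((~` U) y) US.
  by move=> /(_ P SP)/eqP; rewrite (negbTE nPy).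
exists [set P | forall y, ~ U y -> peval P (c y) = 0].
apply/seteqP; split=> [y nUy P /(_ y nUy) //|y Py Uy].
have [f [[P fP] fy fU]] := loc y Uy.
have : peval P (c y) = 0.
  apply: Py => z nUz; rewrite -fP; apply/eqP; apply: contrapT => /negP.
  by move=> /fU.
by move/eqP; rewrite -fP (negbTE fy).
Qed.

Lemma zopen_setT : zopen c setT.
Proof.
apply/zopenP => x _; exists (fun=> 1); split; rewrite ?oner_eq0 //.
exact: zregular_cst.
Qed.

Lemma zopenI (U V : set T) : zopen c U -> zopen c V -> zopen c (U `&` V).
Proof.
move=> /zopenP hU /zopenP hV; apply/zopenP => x [/hU[f [fr fx fU]] /hV[g [gr gx gV]]].
exists (fun y => f y * g y); split; [exact: zregularM|by rewrite mulf_neq0|].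
by move=> y; rewrite mulf_eq0 negb_or => /andP[/fU ? /gV].
Qed.

Lemma zopen_neq0 f : zregular c f -> zopen c [set x | f x != 0].
Proof. by move=> fr; apply/zopenP => x fx; exists f. Qed.
End Regular.

Lemma zopen_preimage (k : fieldType) (N M : nat) (T S : Type) (c : T -> 'rV[k]_N)
    (d : S -> 'rV[k]_M) (h : T -> S) (U : set S) :
  (forall i, zregular c (fun x => d (h x) 0 i)) -> zopen d U -> zopen c (h @^-1` U).
Proof.
move=> hr /zopenP Uo; apply/zopenP => x /Uo[f [[P fP] fx fU]].
exists (f \o h); split=> //; last by move=> y /fU.
by apply: peval_comp hr _; exists P => y; exact: fP.
Qed.

(** k[T x S] is the tensor product of k[T] and k[S]: each monomial splits into
    its two groups of variables.  This is what makes the translates of a regular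
    function span a finite-dimensional space. *)
Lemma zregular_pair_sep (k : fieldType) (N M : nat) (T S : Type)
    (c : T -> 'rV[k]_N) (d : S -> 'rV[k]_M) (F : T * S -> k) :
  zregular (fun z => row_mx (c z.1) (d z.2)) F ->
  exists r (a : 'I_r -> T -> k) (b : 'I_r -> S -> k),
    [/\ forall i, zregular c (a i), forall i, zregular d (b i) &
        forall x y, F (x, y) = \sum_i a i x * b i y].
Proof.
move=> [P hP]; pose s := msupp P.
pose mon i := nth mnm0 s i.
exists (size s), (fun i x => mcoeff (mon i) P * \prod_(j < N) c x 0 j ^+ mon i (lshift M j)).
exists (fun i y => \prod_(j < M) d y 0 j ^+ mon i (rshift N j)); split.
- move=> i; apply: zregularM; first exact: zregular_cst.
  by apply: zregular_prod => j; apply: zregularX; exact: zregular_coord.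
- by move=> i; apply: zregular_prod => j; apply: zregularX; exact: zregular_coord.
move=> x y; rewrite hP /peval mevalE (big_nth mnm0) big_mkord.
apply: eq_bigr => i _; rewrite -mulrA; congr (_ * _).
rewrite big_split_ord /=; congr (_ * _); apply: eq_bigr => j _.
  by rewrite row_mxEl.
by rewrite row_mxEr.
Qed.

(** * Connected linear algebraic groups are irreducible *)

Section GroupRegular.
Variables (k : fieldType) (m : nat) (G : linAlgGroup k m).
Local Notation gc := (@lg_coord k m G).

Lemma zregular_lgentry i j : zregular gc (fun g => lgmx g i j).
Proof.
apply: zregular_ext (zregular_coord gc (lshift 1 (mxvec_index i j))) => g.
by rewrite /lg_coord /gl_coord row_mxEl mxvecE.
Qed.

Lemma zregular_lgdetV : zregular gc (fun g => (\det (lgmx g))^-1).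
Proof.
apply: zregular_ext (zregular_coord gc (rshift (m * m) 0)) => g.
by rewrite /lg_coord /gl_coord row_mxEr mxE.
Qed.

(** A map into [G] is a morphism as soon as the matrix entries and the inverse of
    the determinant are regular. *)
Lemma zregular_lgcoord (N : nat) (T : Type) (c : T -> 'rV[k]_N) (h : T -> lgpt G) :
  (forall i j, zregular c (fun x => lgmx (h x) i j)) ->
  zregular c (fun x => (\det (lgmx (h x)))^-1) ->
  forall i, zregular c (fun x => gc (h x) 0 i).
Proof.
move=> hr hd i; case: (split_ordP i) => j ->.
  case/mxvec_indexP: j => j l; apply: zregular_ext (hr j l) => x.
  by rewrite /lg_coord /gl_coord row_mxEl mxvecE.
by apply: zregular_ext hd => x; rewrite /lg_coord /gl_coord row_mxEr mxE.
Qed.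

Lemma zregular_mul i :
  zregular (fun z : lgpt G * lgpt G => row_mx (gc z.1) (gc z.2))
           (fun z => gc (z.1 * z.2)%g 0 i).
Proof.
set c := fun z => _.
have r1 f : zregular gc f -> zregular c (fun z => f z.1).
  move=> [P fP]; apply: (@peval_comp _ _ _ _ _ (fun z => gc z.1)); last by exists P => z.
  move=> j; apply: zregular_ext (zregular_coord c (lshift _ j)) => z.
  by rewrite row_mxEl.
have r2 f : zregular gc f -> zregular c (fun z => f z.2).
  move=> [P fP]; apply: (@peval_comp _ _ _ _ _ (fun z => gc z.2)); last by exists P => z.
  move=> j; apply: zregular_ext (zregular_coord c (rshift _ j)) => z.
  by rewrite row_mxEr.
apply: (@zregular_lgcoord _ _ _ (fun z => (z.1 * z.2)%g)) => [p q|].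
  suff : zregular c (fun z => \sum_l lgmx z.1 p l * lgmx z.2 l q).
    by apply: zregular_ext => z; rewrite mxE.
  apply: zregular_sum => l; apply: zregularM.
    exact: (r1 (fun g => lgmx g p l) (zregular_lgentry p l)).
  exact: (r2 (fun g => lgmx g l q) (zregular_lgentry l q)).
have := zregularM (r1 _ zregular_lgdetV) (r2 _ zregular_lgdetV).
by apply: zregular_ext => z; rewrite det_mulmx invfM.
Qed.

Lemma zregular_mull h i : zregular gc (fun g => gc (h * g)%g 0 i).
Proof.
have [P hP] := zregular_mul i.
apply: (@peval_comp _ _ _ _ _ (fun g => row_mx (gc h) (gc g))); last first.
  by exists P => g; exact: hP (h, g).
move=> j; case: (split_ordP j) => l ->.
  by apply: zregular_ext (zregular_cst gc (gc h 0 l)) => x; rewrite row_mxEl.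
by apply: zregular_ext (zregular_coord gc l) => x; rewrite row_mxEr.
Qed.

Lemma zregular_mulr h i : zregular gc (fun g => gc (g * h)%g 0 i).
Proof.
have [P hP] := zregular_mul i.
apply: (@peval_comp _ _ _ _ _ (fun g => row_mx (gc g) (gc h))); last first.
  by exists P => g; exact: hP (g, h).
move=> j; case: (split_ordP j) => l ->.
  by apply: zregular_ext (zregular_coord gc l) => x; rewrite row_mxEl.
by apply: zregular_ext (zregular_cst gc (gc h 0 l)) => x; rewrite row_mxEr.
Qed.

Lemma zregular_inv i : zregular gc (fun g => gc g^-1%g 0 i).
Proof.
have rdet : zregular gc (fun g => \det (lgmx g)).
  by apply: zregular_det => p q; exact: zregular_lgentry.
apply: (@zregular_lgcoord _ _ _ (fun g => g^-1%g)) => [p q|].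
  suff : zregular gc (fun g => (\det (lgmx g))^-1 * \adj (lgmx g) p q).
    apply: zregular_ext => g.
    by rewrite -[RHS]/(invmx (lgmx g) p q) /invmx lg_unit [RHS]mxE.
  apply: zregularM; first exact: zregular_lgdetV.
  apply: (@zregular_ext _ _ _ _ (fun g => cofactor (lgmx g) q p)) => [g|].
    by rewrite mxE.
  apply: zregularM; first exact: zregular_cst.
  apply: zregular_det => x y; apply: zregular_ext (zregular_lgentry (lift q x) (lift p y)).
  by move=> g; rewrite !mxE.
by apply: zregular_ext rdet => g; rewrite -[LHS]invrK -det_inv.
Qed.

(** The usual decomposition into irreducible components is replaced by a choice
    adapted to the one function [f].  Its translates span a finite-dimensional
    space, so there is a non-empty open [U] inside [V] so small that a translate of
    [f] vanishing on some non-empty open part of [U] vanishes on [U].  Let [H] be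
    the set of [g] for which the translates vanishing on [U] are the same as those
    vanishing on [g U].  It is a subgroup, and it contains every [g] such that [g U]
    meets [U], hence a neighbourhood of 1.  So [H] is open, its cosets are open,
    and [H = G] by connectedness.  Since [f] vanishes on [U], it vanishes on all
    [g U]. *)
Lemma connected_vanish (f : lgpt G -> k) (V : set (lgpt G)) :
  is_connected G -> zregular gc f -> zopen gc V -> V !=set0 ->
  (forall x, V x -> f x = 0) -> forall x, f x = 0.
Proof.
move=> [_ conn] fr Vo V0 fV.
have [r [a [b [_ _ fE]]]] : exists r (a b : 'I_r -> lgpt G -> k),
    [/\ forall i, zregular gc (a i), forall i, zregular gc (b i) &
        forall x y, f (x * y)%g = \sum_i a i x * b i y].
  have [] := @zregular_pair_sep _ _ _ _ _ gc gc (fun z => f (z.1 * z.2)%g).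
    by apply: (peval_comp zregular_mul); case: fr => P fP; exists P => z; exact: fP.
  by move=> r [a [b [ar br fE]]]; exists r, a, b.
pose bv x := \row_i b i x.
(* the ranks of the spans of [bv @` U], for non-empty open [U] inside [V] *)
pose small d := `[< exists U, [/\ zopen gc U, U !=set0, U `<=` V &
  exists s (A : 'M[k]_(s, r)), [/\ \rank A = d, forall i, (bv @` U) (row i A) &
    forall x, U x -> (bv x <= A)%MS]] >].
have exsmall (W : set (lgpt G)) : zopen gc W -> W !=set0 -> W `<=` V ->
    exists s (A : 'M[k]_(s, r)), [/\ forall i, (bv @` W) (row i A),
      forall x, W x -> (bv x <= A)%MS & small (\rank A)].
  move=> Wo W0 WV; have [s [A [AW WA]]] := exists_spanning_rows (bv @` W).
  have WA' x : W x -> (bv x <= A)%MS by move=> Wx; apply: WA; exists x.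
  exists s, A; split=> //; apply/asboolP; exists W; split=> //.
  by exists s, A.
have : exists d, small d.
  by have [|s [A [_ _ h]]] := exsmall V Vo V0; [by []|exists (\rank A)].
move=> /ex_minnP[d /asboolP[U [Uo U0 UV [s [A [rA AU UA]]]]] mind].
pose Z h := forall u, U u -> f (h * u)%g = 0.
(* [U] is small enough for any non-empty open subset to detect [Z] *)
have ZU W h : zopen gc W -> W !=set0 -> W `<=` U ->
    (forall u, W u -> f (h * u)%g = 0) -> Z h.
  move=> Wo W0 WU fW; have WV := subset_trans WU UV.
  have [s' [A' [A'W WA' smallA']]] := exsmall W Wo W0 WV.
  have A'A : (A' <= A)%MS.
    apply/row_subP => i; have [x Wx <-] := A'W i; exact: UA (WU _ Wx).
  have AA' : (A <= A')%MS.
    rewrite -(mxrank_leqif_sup A'A) eqn_leq mxrankS //= rA; exact: mind.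
  pose l : 'cV[k]_r := \col_i a i h.
  have flE x : f (h * x)%g = (bv x *m l) 0 0.
    by rewrite fE mxE; apply: eq_bigr => i _; rewrite !mxE mulrC.
  have A'l : A' *m l = 0.
    apply/row_matrixP => i; have [x Wx xE] := A'W i.
    by rewrite row_mul -xE row0; apply/rowP => j; rewrite ord1 -flE fW // mxE.
  move=> u Uu; rewrite flE.
  have /submxP[D ->] := submx_trans (UA u Uu) AA'.
  by rewrite -mulmxA A'l mulmx0 mxE.
have lo g W : zopen gc W -> zopen gc [set x | W (g * x)%g].
  by apply: zopen_preimage => i; exact: zregular_mull.
have ro g W : zopen gc W -> zopen gc [set x | W (x * g)%g].
  by apply: zopen_preimage => i; exact: zregular_mulr.
have [u0 Uu0] := U0.
pose H : set (lgpt G) := [set g | forall h, Z (h * g)%g <-> Z h].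
have H1 : H 1%g by move=> h; rewrite mulg1.
have HM g g' : H g -> H g' -> H (g * g')%g.
  by move=> Hg Hg' h; rewrite mulgA (Hg' _).
have HV g : H g -> H g^-1%g by move=> Hg h; rewrite -(Hg (h * g^-1)%g) mulgVK.
have HN g : U (g * u0)%g -> H g.
  move=> Ug h; split=> zh.
    apply: (ZU (U `&` [set x | U (g^-1 * x)%g])).
    - by apply: zopenI => //; exact: lo.
    - by exists (g * u0)%g; split=> //=; rewrite mulKg.
    - by move=> x [].
    - by move=> x [_ /= Ux]; have := zh _ Ux; rewrite -mulgA mulVKg.
  apply: (ZU (U `&` [set x | U (g * x)%g])).
  - by apply: zopenI => //; exact: lo.
  - by exists u0.
  - by move=> x [].
  - by move=> x [_ /= Ux]; rewrite -mulgA; exact: zh.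
(* every [g] has the open neighbourhood [g * (U * u0^-1)] in its coset of [H] *)
have nbhs g : exists N, [/\ zopen gc N, N g & forall x, N x -> H (g^-1 * x)%g].
  exists [set x | U (g^-1 * (x * u0))%g]; split.
  - exact: (@ro u0 [set x | U (g^-1 * x)%g] (lo g^-1%g U Uo)).
  - by rewrite /= mulKg.
  - by move=> x /=; rewrite mulgA => /HN.
have locopen (W : set (lgpt G)) :
    (forall g x, W g -> H (g^-1 * x)%g -> W x) -> zopen gc W.
  move=> Wcoset; apply/zopenP => g Wg; have [N [/zopenP No Ng NH]] := nbhs g.
  have [p [pr pg pN]] := No g Ng; exists p; split=> // y /pN /NH; exact: Wcoset.
have Ho : zopen gc H.
  by apply: locopen => g x Hg Hx; rewrite -[x](mulVKg g); exact: HM.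
have HCo : zopen gc (~` H).
  apply: locopen => g x nHg Hx Hx'; apply: nHg.
  rewrite (_ : g = x * (g^-1 * x)^-1)%g; first exact: HM (HV _ Hx).
  by rewrite invgM invgK mulVKg.
have Hc : zclosed gc H by rewrite -[H]setCK.
have HT g : H g.
  have [||h|h] := conn H (~` H) Hc Ho.
  - by move=> x _; have [] := pselect (H x); [left|right].
  - by apply/seteqP; split=> // x [[_ Hx]].
  - exact: h.
  - by case: (h 1%g I).
move=> x; have Z1 : Z 1%g by move=> u Uu; rewrite mul1g; exact/fV/UV.
have := HT (x * u0^-1)%g 1%g; rewrite mul1g => -[_ /(_ Z1) /(_ u0 Uu0)].
by rewrite mulgVK.
Qed.

Lemma connected_open_meet (U V : set (lgpt G)) : is_connected G ->
  zopen gc U -> zopen gc V -> U !=set0 -> V !=set0 -> U `&` V !=set0.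
Proof.
move=> Gc Uo Vo [x Ux] V0; have [f [fr fx fU]] := (zopenP _ _).1 Uo x Ux.
apply: contrapT => UV0; move: fx; rewrite (connected_vanish Gc fr Vo V0) ?eqxx //.
move=> y Vy; apply/eqP; apply: contrapT => /negP /fU Uy; apply: UV0; by exists y.
Qed.

Lemma generically_and (P Q : lgpt G -> Prop) : is_connected G ->
  generically P -> generically Q -> exists g, P g /\ Q g.
Proof.
move=> Gc [U [Uo U0 UP]] [V [Vo V0 VQ]].
by have [g [/UP ? /VQ ?]] := connected_open_meet Gc Uo Vo U0 V0; exists g.
Qed.

Lemma generically_inv (P : lgpt G -> Prop) :
  generically P -> generically (fun g => P g^-1%g).
Proof.
move=> [U [Uo [g Ug] UP]]; exists [set x | U x^-1%g]; split.
- by apply: zopen_preimage Uo => i; exact: zregular_inv.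
- by exists g^-1%g; rewrite /= invgK.
- by move=> x /UP.
Qed.
End GroupRegular.

(** * The invariant valuation attached to a valuation of k[Y] *)

Section Valuations.
Variables (R : realType) (k : fieldType) (B : comAlgType k) (v : B -> \bar R).
Hypothesis vP : is_valuation (in_alg B) v.

Lemma valZ c f : c != 0 -> v (c *: f) = v f.
Proof. by case: vP => _ _ vc vM _ c0; rewrite -mulr_algl vM [X in (X + _)%E]vc // add0e. Qed.

Lemma valZ_ge m c f : (m <= v f)%E -> (m <= v (c *: f))%E.
Proof.
have [->|c0] := eqVneq c 0; last by rewrite valZ.
by rewrite scale0r; case: vP => _ -> _ _ _; rewrite leey.
Qed.

Lemma valD_ge m f g : (m <= v f -> m <= v g -> m <= v (f + g)%R)%E.
Proof.
case: vP => _ _ _ _ /(_ f g) h mf mg.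
by apply: le_trans h; rewrite le_min mf mg.
Qed.

Lemma valD_gt m f g : (m < v f -> m < v g -> m < v (f + g)%R)%E.
Proof.
case: vP => _ _ _ _ /(_ f g) h mf mg.
by apply: lt_le_trans h; rewrite lt_min mf mg.
Qed.

Lemma val_comb_ge (I : finType) m (c : I -> k) (F : I -> B) :
  (forall i, m <= v (F i))%E -> (m <= v (\sum_i c i *: F i)%R)%E.
Proof.
move=> mF; elim/big_ind: _ => [|f g|i _]; [|exact: valD_ge|exact: valZ_ge].
by case: vP => _ -> _ _ _; rewrite leey.
Qed.
End Valuations.

Section GenericValue.
Variables (k : fieldType) (m : nat) (G : linAlgGroup k m).
Local Notation gc := (@lg_coord k m G).

(** The points [gs j] come from a finite family of coefficient vectors [c g]
    spanning all of them; they do not depend on [v].  Genericity: a linear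
    functional that vanishes where the valuation exceeds [vmin], but not at some
    [gs j], pulls back to a regular function of [g]. *)
Lemma generic_val_comb (B : comAlgType k) (r : nat) (c : 'I_r -> lgpt G -> k)
    (w : 'I_r -> B) : (forall i, zregular gc (c i)) ->
  let F g := \sum_i c i g *: w i in
  exists s (gs : 'I_s -> lgpt G), forall (R : realType) (v : B -> \bar R),
    is_valuation (in_alg B) v ->
    let vmin := (\big[mine/+oo]_j v (F (gs j)))%E in
    (forall g, vmin <= v (F g))%E /\ generically (fun g => vmin = v (F g)).
Proof.
move=> cr F; pose cv g := \row_i c i g; pose L (u : 'rV[k]_r) := \sum_i u 0 i *: w i.
have FE g : F g = L (cv g) by apply: eq_bigr => i _; rewrite mxE.
have [s [A [AG spanA]]] := exists_spanning_rows (range cv).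
(* each row of [A] is the coefficient vector of some group element *)
have /choice[gs gsE] : forall i, exists g, cv g = row i A.
  by move=> i; have [g _ <-] := AG i; exists g.
exists s, gs => R v vP vmin.
have vmin_le g : (vmin <= v (F g))%E.
  have /submxP[D cvE] : (cv g <= A)%MS by apply: spanA; exists g.
  have -> : F g = \sum_j D 0 j *: F (gs j).
    rewrite FE /L cvE; under [RHS]eq_bigr do rewrite FE /L scaler_sumr.
    rewrite exchange_big; apply: eq_bigr => i _ /=; rewrite mxE scaler_suml.
    by apply: eq_bigr => j _; rewrite scalerA gsE mxE.
  by apply: (val_comb_ge vP) => j; exact: bigmin_le.
split=> //; have [vminy|] := boolP (vmin == +oo%E).
  exists setT; split; [exact: zopen_setT|by exists 1%g|move=> g _].
  by apply/le_anti; rewrite vmin_le (eqP vminy) leey.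
(* [vmin] is finite, hence attained *)
rewrite -ltey => vminy.
have [j vj] : exists j, ~ (vmin < v (F (gs j)))%E.
  apply: contrapT => /forallNP h; suff : (vmin < vmin)%E by rewrite ltxx.
  by apply/bigmin_gtP; split=> // j _; apply: contrapT; exact: h.
have [|||l [lS lj]] := @separating_functional k r [set u | (vmin < v (L u))%E] (cv (gs j)).
- rewrite /= /L big1 => [|i _]; first by case: vP => _ -> _ _ _.
  by rewrite mxE scale0r.
- move=> a u u' hu hu' /=.
  have -> : L (a *: u + u') = a *: L u + L u'.
    rewrite /L scaler_sumr -big_split; apply: eq_bigr => i _ /=.
    by rewrite !mxE scalerDl scalerA.
  apply: (valD_gt vP) => //; have [->|a0] := eqVneq a 0; last by rewrite (valZ vP).
  by rewrite scale0r; case: vP => _ -> _ _ _.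
- by rewrite /= -FE.
exists [set g | (cv g *m l) 0 0 != 0]; split; last 2 first.
- by exists (gs j).
- move=> g /= lg; apply/le_anti; rewrite vmin_le leNgt; apply/negP => h.
  by move: lg; rewrite lS ?eqxx //= -FE.
apply: zopen_neq0; apply: (@zregular_ext _ _ _ _ (fun g => \sum_i c i g * l i 0)).
  by move=> g; rewrite mxE; apply: eq_bigr => i _; rewrite mxE.
by apply: zregular_sum => i; apply: zregularM => //; exact: zregular_cst.
Qed.
End GenericValue.

Lemma coord_sum (k : fieldType) (n : nat) (X : affineSet k n) (I : finType)
    (F : I -> coordRing X) x : (\sum_i F i) x = \sum_i F i x.
Proof. exact: (big_morph (fun f : coordRing X => f x) (fun f g => coordD f g x) (coord_zero x)). Qed.

Section Bar.
Variables (R : realType) (k : fieldType) (m n : nat) (G : linAlgGroup k m).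
Variables (X : affineVariety k n) (a : action G X) (Y : affineSet k n) (YX : Y `<=` X).
Local Notation gc := (@lg_coord k m G).
Local Notation piT g f := (restr YX (translate a g f)).

(** Rationality of the action of [G] on k[X]: the translates of [f] span a
    finite-dimensional space, and their coordinates are regular on [G]. *)
Lemma translate_comb (f : coordRing X) :
  exists r (c : 'I_r -> lgpt G -> k) (u : 'I_r -> coordRing X),
    (forall i, zregular gc (c i)) /\ forall g, translate a g f = \sum_i c i g *: u i.
Proof.
have [] := @zregular_pair_sep k _ _ _ _ gc (@pt k n X) (fun z => f (a z.1 z.2)).
  apply: (@peval_comp _ _ _ _ _ (fun z => pt (a z.1 z.2))) (act_regular a) _.
  by have /asboolP[P fP] := coord_regular f; exists P => z; exact: fP.
move=> r [c [b [cr br fE]]].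
have bc i : coord_pred (b i) by exact/asboolP.
exists r, (fun i g => c i g^-1%g), (fun i => Coord (bc i)); split.
  move=> i; apply: (@peval_comp _ _ _ _ _ (fun g : lgpt G => gc g^-1%g)).
    exact: zregular_inv.
  by case: (cr i) => P cP; exists P => g; exact: cP.
by move=> g; apply: coordP => x; rewrite coord_sum /=; exact: (fE g^-1%g x).
Qed.

Lemma restr_sum (I : finType) (c : I -> k) (u : I -> coordRing X) :
  restr YX (\sum_i c i *: u i) = \sum_i c i *: restr YX (u i).
Proof. by apply: coordP => y /=; rewrite !coord_sum. Qed.

Lemma generic_val_restr (f : coordRing X) :
  exists s (gs : 'I_s -> lgpt G), forall v : coordRing Y -> \bar R,
    is_valuation (in_alg (coordRing Y)) v ->
    let vmin := (\big[mine/+oo]_j v (piT (gs j) f))%E in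
    (forall g, vmin <= v (piT g f))%E /\ generically (fun g => vmin = v (piT g f)).
Proof.
have [r [c [u [cr uE]]]] := translate_comb f.
have [s [gs gsP]] := generic_val_comb (fun i => restr YX (u i)) cr.
exists s, gs => v /gsP.
have E g : piT g f = \sum_i c i g *: restr YX (u i) by rewrite uE restr_sum.
rewrite /=; under eq_bigr do rewrite -E; move=> [h1 [U [Uo U0 h2]]].
by split=> [g|]; [rewrite E|exists U; split=> // g /h2; rewrite E].
Qed.

Lemma translateM g h (f : coordRing X) :
  translate a g (translate a h f) = translate a (g * h)%g f.
Proof. by apply: coordP => x /=; rewrite invgM actM. Qed.

Lemma translate1 (f : coordRing X) : translate a 1%g f = f.
Proof. by apply: coordP => x /=; rewrite invg1 act1. Qed.

Lemma exists_bar (v : coordRing Y -> \bar R) : is_connected G ->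
  is_valuation (in_alg (coordRing Y)) v ->
  exists w : invValuation a R, is_bar a YX v w.
Proof.
move=> Gc vP.
have /choice[w wP] : forall f : coordRing X, exists c : \bar R,
    (forall g, c <= v (piT g f))%E /\ generically (fun g => c = v (piT g f)).
  by move=> f; have [s [gs /(_ v vP)]] := generic_val_restr f; eexists; eassumption.
have gen1 f : exists g, w f = v (piT g f).
  by have [_ [U [_ [g Ug] UP]]] := wP f; exists g; exact: UP.
have wval : is_valuation (in_alg (coordRing X)) w.
  case: (vP) => vNy v0 vc vM vD; split.
  - by move=> f; have [g ->] := gen1 f; exact: vNy.
  - have [g ->] := gen1 0.
    by rewrite (_ : piT g 0 = 0) //; exact: coordP.
  - move=> c c0; have [g ->] := gen1 (in_alg (coordRing X) c).
    by rewrite -(vc c c0); congr v; exact: coordP.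
  - move=> f f'; have [g [[ef ef'] e]] :
        exists g, (w f = v (piT g f) /\ w f' = v (piT g f')) /\
                  w (f * f') = v (piT g (f * f')).
      have [[U1 [U1o U10 h1]] [U2 [U2o U20 h2]]] := ((wP f).2, (wP f').2).
      apply: generically_and (wP (f * f')).2 => //.
      exists (U1 `&` U2); split; [exact: zopenI|exact: connected_open_meet|].
      by move=> g [/h1 ? /h2].
    rewrite ef ef' e -vM; congr v; exact: coordP.
  - move=> f f'; have [g ->] := gen1 (f + f').
    have -> : piT g (f + f') = piT g f + piT g f' by exact: coordP.
    apply: valD_ge => //.
      by apply: le_trans ((wP f).1 g); rewrite ge_min lexx.
    by apply: le_trans ((wP f').1 g); rewrite ge_min lexx orbT.
have wle g f : (w f <= w (translate a g f))%E.
  by have [h ->] := gen1 (translate a g f); rewrite translateM; exact: (wP f).1.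
have winv g f : w (translate a g f) = w f.
  apply/le_anti; rewrite wle andbT.
  by have := wle g^-1%g (translate a g f); rewrite translateM mulVg translate1.
exists (InvValuation wval winv) => f; exact: (wP f).2.
Qed.

Lemma barP (v : coordRing Y -> \bar R) : is_connected G ->
  is_valuation (in_alg (coordRing Y)) v -> is_bar a YX v (bar a YX v).
Proof.
move=> Gc vP; rewrite /bar; case: xgetP => [w _ //|none].
by have [w /none] := exists_bar Gc vP.
Qed.

Lemma bar_le (v : coordRing Y -> \bar R) g f : is_connected G ->
  is_valuation (in_alg (coordRing Y)) v -> (bar a YX v f <= v (piT g f))%E.
Proof.
move=> Gc vP; have [s [gs /(_ v vP)[vle vE]]] := generic_val_restr f.
by have [h [-> <-]] := generically_and Gc (barP Gc vP f) vE.
Qed.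

(** The group elements [gs j] serve all valuations [v] at once; continuity of
    [v |-> bar v f] rests on this uniformity. *)
Lemma bar_bigmin (f : coordRing X) : is_connected G ->
  exists s (gs : 'I_s -> lgpt G), forall v : coordRing Y -> \bar R,
    is_valuation (in_alg (coordRing Y)) v ->
    bar a YX v f = (\big[mine/+oo]_j v (piT (gs j) f))%E.
Proof.
move=> Gc; have [s [gs gsP]] := generic_val_restr f; exists s, gs => v vP.
have [_ vE] := gsP v vP.
by have [h [-> <-]] := generically_and Gc (barP Gc vP f) vE.
Qed.
End Bar.

(** * Finiteness over the open orbit, extension to k(X), and continuity *)

(** If [bar v f] is infinite then so are all [v (pi (g f))], so [f] vanishes on
    the orbit of [y]; as this orbit is open in the irreducible [X], [f = 0]. *)
Lemma bar_lty (R : realType) (k : fieldType) (m n : nat) (G : linAlgGroup k m)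
    (X : affineVariety k n) (a : action G X) (Y : affineSet k n) (YX : Y `<=` X)
    (v : coordRing Y -> \bar R) (f : coordRing X) (y : Y) :
  is_connected G -> is_valuation (in_alg (coordRing Y)) v ->
  in_open_orbit a (Defs.incl YX y) -> (forall h, v h = +oo%E -> h y = 0) ->
  f != 0 -> (bar a YX v f < +oo)%E.
Proof.
move=> Gc vP yo vy /eqP f0; rewrite ltey; apply/eqP => fy; apply: f0.
have f0 g : f (a g (Defs.incl YX y)) = 0.
  have := bar_le a YX g^-1%g f Gc vP; rewrite fy leye_eq => /eqP /vy /=.
  by rewrite invgK.
have [_ irr] := av_irreducible X.
have fcl : zclosed (@pt k n X) [set x | f x = 0].
  have /asboolP[P hP] := coord_regular f; exists [set P].
  apply/seteqP; split=> x /=; first by move=> hx Q ->; rewrite -hP.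
  by move=> /(_ P erefl); rewrite -hP.
have [|h|h] := irr _ _ fcl yo.
- move=> x _; have [[g _ <-]|] := pselect (actOrbit a setT (Defs.incl YX y) x); last by right.
  by left; exact: f0.
- by apply: coordP => x; exact: h.
- by exfalso; apply: (h (Defs.incl YX y) I); exists 1%g => //; exact: act1.
Qed.

Lemma funfield_fracP (k : fieldType) (n : nat) (X : affineVariety k n) (phi : funfield X) :
  exists p : coordRing X * coordRing X,
    p.2 != 0 /\ phi = funfield_of p.1 / funfield_of p.2.
Proof.
exists (repr phi); split; first exact: denom_ratioP.
have d0 : funfield_of (repr phi).2 != 0.
  by rewrite /funfield_of tofrac_eq0 denom_ratioP.
apply: (mulIf d0); rewrite divfK // -{1}[phi]reprK /funfield_of.
unlock FracField.tofrac.
rewrite -[LHS]FracField.pi_mul; apply/eqmodP; rewrite /= FracField.equivfE.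
rewrite /FracField.mulf !numden_Ratio ?oner_eq0 ?mulr1 ?denom_ratioP //.
by rewrite mulrC.
Qed.

(** Two fractions that represent the same element satisfy [f g' = f' g], so that
    [v f - v g] does not depend on the representation; [f] may be zero, which
    gives the value +oo at 0. *)
Lemma invValuation_extend (R : realType) (k : fieldType) (m n : nat)
    (G : linAlgGroup k m) (X : affineVariety k n) (a : action G X)
    (v : invValuation a R) : (forall f, f != 0 -> (v f < +oo)%E) ->
  exists w, [/\ inv_field_valuation (R := R) a w,
    forall f, w (funfield_of f) = v f &
    forall f g, g != 0 -> w (funfield_of f / funfield_of g) = (v f - v g)%E].
Proof.
move=> vfin; have [vNy v0 vc vM vD] := inv_val_valuation v.
have vfn f : f != 0 -> v f \is a fin_num.
  by move=> /vfin h; rewrite fin_numE vNy /= -ltey.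
have ff0 (f : coordRing X) : (funfield_of f == 0) = (f == 0) by exact: tofrac_eq0.
have /choice[nd ndP] := @funfield_fracP k n X.
pose w phi := (v (nd phi).1 - v (nd phi).2)%E.
have wE f g : g != 0 -> w (funfield_of f / funfield_of g) = (v f - v g)%E.
  move=> g0; rewrite /w; have [] := ndP (funfield_of f / funfield_of g).
  move: (nd _) => [f' g'] /= g'0 /eqP; rewrite eqr_div ?ff0 // -!rmorphM.
  rewrite -subr_eq0 -rmorphB ff0 subr_eq0 => /eqP /(congr1 v); rewrite !vM.
  have := vfn _ g0; have := vfn _ g'0; have := vNy f; have := vNy f'.
  case: (v g) => [u| |] //; case: (v g') => [u'| |] //.
  case: (v f) => [t| |] //; case: (v f') => [t'| |] // _ _ _ _ [e].
  by congr _%:E; apply/eqP; rewrite subr_eq addrAC eq_sym subr_eq e.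
have v1 : v 1 = 0%E by rewrite -(vc 1) ?oner_eq0 //= scale1r.
have wof f : w (funfield_of f) = v f.
  by rewrite -[funfield_of f]divr1 -[1](rmorph1 (@funfield_of k n X)) wE ?oner_eq0 // v1 sube0.
exists w; split=> //; split; last first.
  move=> g f1 f2; have [->|f20] := eqVneq f2 0.
    have -> : translate a g 0 = 0 by exact: coordP.
    by rewrite rmorph0 invr0 !mulr0.
  rewrite !wE ?inv_val_inv //; apply: contraTneq (vfin _ f20) => f20'.
  by rewrite -(inv_val_inv v g) f20' v0 ltxx.
split.
- move=> phi; have [g0 ->] := ndP phi; rewrite wE //.
  have := vNy (nd phi).1; have := vfn _ g0.
  by case: (v (nd phi).1) => [?| |]; case: (v _).
- by rewrite -[0](rmorph0 (@funfield_of k n X)) wof.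
- by move=> c c0; rewrite wof; exact: vc.
- move=> phi psi; have [g0 ->] := ndP phi; have [g'0 ->] := ndP psi.
  rewrite mulf_div -!rmorphM !wE ?mulf_neq0 // !vM.
  have := vfn _ g0; have := vfn _ g'0; have := vNy (nd phi).1; have := vNy (nd psi).1.
  case: (v (nd phi).1) => [t| |] //; case: (v (nd psi).1) => [t'| |] //;
  case: (v (nd phi).2) => [u| |] //; case: (v (nd psi).2) => [u'| |] // _ _ _ _.
  by rewrite -!EFinD opprD addrACA.
- move=> phi psi; have [g0 ->] := ndP phi; have [g'0 ->] := ndP psi.
  move: (nd phi).1 (nd phi).2 (nd psi).1 (nd psi).2 g0 g'0 => f g f' g' g0 g'0.
  rewrite addf_div ?ff0 // -!rmorphM -rmorphD !wE ?mulf_neq0 // !vM.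
  have := vD (f * g') (f' * g); rewrite !vM.
  have := vfn _ g0; have := vfn _ g'0; have := vNy f; have := vNy f'.
  have := vNy (f * g' + f' * g).
  case: (v g) => [u| |] //; case: (v g') => [u'| |] //.
  case: (v (f * g' + f' * g)) => [t| |] // _.
    case: (v f) => [q| |] //; case: (v f') => [q'| |] // _ _ _ _;
      rewrite !ge_min => /orP[] // h; apply/orP; [left|right|left|right] => //;
      move: h; rewrite -?EFinD !lee_fin => h; clear -h; lra.
  by move=> *; rewrite addye ?leey.
Qed.

Section NegLog.
Variable R : realType.
Local Notation nlog x := (- lne (x%:E : \bar R))%E.

Lemma le_nlog (x y : R) : x <= y -> (nlog y <= nlog x)%E.
Proof.
move=> xy; rewrite leeN2; have [x0|x0] := leP x 0.
  by rewrite [X in (X <= _)%E]le0_lneNy ?lee_fin // leNye.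
rewrite lee_lne ?lee_fin // in_itv /= leey andbT lee_fin ltW //.
exact: lt_le_trans xy.
Qed.

Lemma nlog_max (x y : R) : nlog (Num.max x y) = mine (nlog x) (nlog y).
Proof.
have [xy|/ltW xy] := leP x y.
  by apply/esym/min_idPr; exact: le_nlog.
by apply/esym/min_idPl; exact: le_nlog.
Qed.

Lemma nlogM (x y : R) : 0 <= x -> 0 <= y -> nlog (x * y) = (nlog x + nlog y)%E.
Proof.
have nlogNy z : nlog z != -oo%E by rewrite /lne; case: ifP.
have nlog0 : nlog 0 = +oo%E by rewrite le0_lneNy.
rewrite le_eqVlt => /predU1P[<- _|x0]; first by rewrite mul0r nlog0 addye.
rewrite le_eqVlt => /predU1P[<-|y0]; first by rewrite mulr0 nlog0 addey.
by rewrite !lne_EFin ?mulr_gt0 // lnM ?posrE // -EFinN opprD.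
Qed.

(** At 0 the value is +oo, and it is the limit there; on negative numbers the
    function is constant. *)
Lemma nlog_continuous : continuous (fun x : R => nlog x).
Proof.
move=> x; apply: (@continuous_comp _ _ _ (fun x : R => lne x%:E) oppe); last first.
  exact: oppe_continuous.
have [x0|x0|->] := ltgtP x 0.
- apply: (near_cst_continuous -oo%E); near=> y; rewrite le0_lneNy // lee_fin ltW //.
  by near: y; exact: lt_nbhsl.
- have npos : \forall y \near x, 0 < y by exact: lt_nbhsr.
  rewrite /prop_for /continuous_at (lne_EFin x0); apply: cvg_EFin.
    by apply: filterS npos => y y0; rewrite lne_EFin.
  apply: cvg_trans (continuous_ln x0); apply: near_eq_cvg.
  by apply: filterS npos => y y0; rewrite /comp lne_EFin.
- rewrite /prop_for /continuous_at (@le0_lneNy _ 0%:E) //; apply/cvgeNyPle => A.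
  near=> y; have [y0|y0] := leP y 0; first by rewrite le0_lneNy ?lee_fin // leNye.
  rewrite lne_EFin // lee_fin -[A]expRK ler_ln ?posrE ?expR_gt0 // ltW //.
  by near: y; apply: lt_nbhsl; exact: expR_gt0.
Unshelve. all: by end_near. Qed.
End NegLog.

Section Seminorms.
Variables (R : realType) (k : fieldType) (n : nat) (Y : affineSet k n).

Lemma tensMl (f g : coordRing Y) :
  tens (f * g) (1 : laurent k) = tens f 1 * tens g 1.
Proof.
apply: tens_ext => V b hb; rewrite [in RHS]tens_liftM // tens_lift_tens //.
rewrite tens_lift_tens; last exact: bil_liftM.
by rewrite tens_lift_tens ?mul1r; [|exact: bilM].
Qed.

Lemma tensDl (f g : coordRing Y) :
  tens (f + g) (1 : laurent k) = tens f 1 + tens g 1.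
Proof.
apply: tens_ext => V b hb; rewrite [in RHS]tens_liftD // !tens_lift_tens //.
by have /= := hb.1 1 1 f g; rewrite !scale1r.
Qed.

(** The scalars of k[Y] and those of k((t)) agree in the tensor product; this
    transfers the normalization of [p] on k((t)) to k[Y]. *)
Lemma tens_alg c : tens (in_alg (coordRing Y) c) (1 : laurent k) = tens 1 (laurent_const c).
Proof.
apply: tens_ext => V b hb; rewrite !tens_lift_tens //.
have b10 : b 1 0 = 0 by have /= := hb.2 1 (-1) 0 0; rewrite !scaleN1r oppr0 addr0 addNr.
have /= := hb.1 1 c 1 0; have /= := hb.2 1 c 1 0.
rewrite !addr0 (bil0l hb) b10 !addr0 => <- ->.
by congr b; exact: mulr1.
Qed.

Lemma seminorm_valuation (p : analytification R Y) :
  is_valuation (in_alg (coordRing Y)) (seminorm_val p).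
Proof.
have [_ ord0 ordc _ _] := ordt_valuation R k.
have vc c : seminorm_val p (in_alg (coordRing Y) c) = ordt R (laurent_const c).
  by rewrite /seminorm_val tens_alg seminorm_const expeRK oppeK.
split.
- by move=> f; rewrite /seminorm_val /lne; case: ifP.
- by have := vc 0; rewrite /= scale0r rmorph0 ord0.
- by move=> c c0; rewrite vc ordc.
- by move=> f g; rewrite /seminorm_val tensMl seminormM nlogM // seminorm_ge0.
- move=> f g; rewrite /seminorm_val tensDl -nlog_max; apply: le_nlog.
  exact: seminorm_ultra.
Qed.

Lemma ordt_Kpoint_valuation (gamma : Kpoint Y) :
  is_valuation (in_alg (coordRing Y)) (fun f => ordt R (gamma f)).
Proof.
have [oNy o0 oc oM oD] := ordt_valuation R k; split.
- by [].
- by rewrite rmorph0.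
- move=> c c0; rewrite -(oc c c0); congr ordt.
  by rewrite /= linearZ rmorph1; exact: mulr1.
- by move=> f g; rewrite rmorphM oM.
- by move=> f g; rewrite rmorphD oD.
Qed.

Lemma seminorm_val_Kpoint (gamma : Kpoint Y) :
  seminorm_val (Kpoint_an R gamma) = (fun f => ordt R (gamma f)).
Proof.
apply/funext => f.
have [oNy _ _ _ _] := ordt_valuation R k.
have E (z : laurent k) : (fine (expeR (- ordt R z)))%:E = expeR (- ordt R z).
  by have := oNy z; case: (ordt R z).
rewrite /seminorm_val -[Kpoint_an R gamma _]/(Kpoint_seminorm R gamma _).
by rewrite /Kpoint_seminorm E expeRK oppeK Kpoint_eval_tens mul1r.
Qed.
End Seminorms.

Section Continuity.
Variables (R : realType) (k : fieldType) (m n : nat) (G : linAlgGroup k m).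
Variables (X : affineVariety k n) (a : action G X) (Y : affineSet k n) (YX : Y `<=` X).

Lemma seminorm_continuous F : continuous (fun p : analytification R Y => p F).
Proof.
pose T := {ptws tensor (coordRing Y) (laurent k) -> R}.
pose sn (p : analytification R Y) : T := p.
have snc : continuous sn by exact: initial_continuous.
move=> p; apply: (@continuous_comp _ _ _ sn (fun u : T => u F)); first exact: snc.
exact: proj_continuous.
Qed.

(** The universal property of the topology of pointwise convergence. *)
Lemma continuous_invValuation (T : topologicalType) (h : T -> invValuation a R) :
  (forall f, continuous (fun p => h p f)) -> continuous h.
Proof.
move=> hc; apply: continuous_comp_initial => p; apply/cvg_sup => f.
by apply: continuous_comp_initial; exact: hc.
Qed.

Lemma Trop_an_continuous : is_connected G ->
  continuous (Trop_an a YX : analytification R Y -> invValuation a R).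
Proof.
move=> Gc; apply: continuous_invValuation => f.
have [s [gs gsE]] := bar_bigmin R a YX f Gc.
pose mx (p : analytification R Y) :=
  \big[Num.max/0]_j p (tens (restr YX (translate a (gs j) f)) 1).
have -> : (fun p => Trop_an a YX p f) = (fun p => - lne (mx p)%:E)%E.
  apply/funext => p; rewrite /Trop_an (gsE _ (seminorm_valuation p)) /mx.
  elim/big_rec2: _ => [|j x y _ ->]; first by rewrite le0_lneNy.
  by rewrite nlog_max.
suff mxc : continuous mx.
  move=> p; apply: (@continuous_comp _ _ _ mx (fun x : R => - lne x%:E)%E).
    exact: mxc.
  exact: nlog_continuous.
rewrite /mx; elim: (index_enum _) => [|j t IH].
  rewrite (_ : (fun p => _) = cst 0); first exact: cst_continuous.
  by apply/funext => p; rewrite big_nil.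
rewrite (_ : (fun p => _) = (fun p : analytification R Y =>
  Num.max (p (tens (restr YX (translate a (gs j) f)) 1))
    (\big[Num.max/0]_(i <- t) p (tens (restr YX (translate a (gs i) f)) 1)))).
  move=> p; apply: continuous_max; last exact: IH.
  exact: seminorm_continuous.
by apply/funext => p; rewrite big_cons.
Qed.
End Continuity.

(** * The two tropicalization maps *)

(** [g . gamma] evaluates [f] to [gamma (pi (g^-1 f))], whereas [bar] uses
    [pi (g f)]: the two generic conditions correspond under inversion. *)
Lemma Trop_eq_bar (R : realType) (k : fieldType) (m n : nat) (G : linAlgGroup k m)
    (X : affineVariety k n) (a : action G X) (Y : affineSet k n) (YX : Y `<=` X)
    (gamma : Kpoint Y) :
  Trop R a YX gamma = bar a YX (fun f => ordt R (gamma f)).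
Proof.
congr xget; apply/funext => w; apply/propext.
split=> h f; have := generically_inv (h f); rewrite /translate_eval //.
by move=> [U [Uo U0 UP]]; exists U; split=> // g /UP; rewrite invgK.
Qed.

Lemma ordt_rat (R : realType) (k : fieldType) (z : laurent k) :
  z != 0 -> exists q : rat, ordt R z = (ratr q)%:E.
Proof.
move=> z0; rewrite /ordt (negbTE z0).
by eexists (_%:R - _%:R); rewrite rmorphB /= !ratr_nat.
Qed.

Theorem proposition5p19 (R : realType) (k : closedFieldType)
    (k_char0 : [pchar k] =i pred0) (m n : nat)
    (G : linAlgGroup k m) (G_connected : is_connected G)
    (G_reductive : is_reductive G)
    (X : affineVariety k n) (a : action G X) (X_spherical : is_spherical a)
    (Y : affineSet k n) (YX : Y `<=` X) (Y_open : meets_open_orbit a YX) :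
  (* well-definedness of the two tropicalization maps, and their relation with
     valuations of k(X) over the open orbit *)
  [/\ forall p : analytification R Y,
        is_bar a YX (seminorm_val p) (Trop_an a YX p),
      forall p : analytification R Y, in_open_orbit_an a YX p ->
        exists2 w, inv_field_valuation (R := R) a w &
          forall f, w (funfield_of f) = Trop_an a YX p f,
      forall gamma : Kpoint Y, is_trop a YX gamma (Trop R a YX gamma) &
      forall gamma : Kpoint Y, in_open_orbit_K a YX gamma ->
        exists2 w, inv_field_valuation_rat (R := R) a w &
          forall f, w (funfield_of f) = Trop R a YX gamma f]
  /\
  (* (1) *)
  continuous (Trop_an a YX : analytification R Y -> invValuation a R)
  /\
  (* (2) *)
  forall gamma : Kpoint Y,
    Trop_an a YX (Kpoint_an R gamma) = Trop R a YX gamma.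
Proof.
have Gc := G_connected.
have TropE := Trop_eq_bar R a YX; split; [split|split].
- by move=> p; exact: (barP a YX Gc (seminorm_valuation p)).
- move=> p [y [yo py]].
  have [|w [wP wE _]] := @invValuation_extend _ _ _ _ _ _ _ (Trop_an a YX p).
    move=> f; apply: (bar_lty Gc (seminorm_valuation p) yo) => h ph; apply: py.
    apply/eqP; case: ltgtP (seminorm_ge0 p (tens h 1)) => // ph0 _.
    by move: ph; rewrite /seminorm_val lne_EFin.
  by exists w.
- move=> gamma f; rewrite TropE.
  have := generically_inv (barP a YX Gc (ordt_Kpoint_valuation R gamma) f).
  exact.
- move=> gamma [y [yo gy]].
  have oP := ordt_Kpoint_valuation R gamma.
  have fin f : f != 0 -> (Trop R a YX gamma f < +oo)%E.
    rewrite TropE; apply: (bar_lty Gc oP yo) => h; rewrite /ordt.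
    by case: eqP => // gh _; exact: gy.
  have rat_val f : f != 0 -> exists q : rat, Trop R a YX gamma f = (ratr q)%:E.
    move=> /fin; rewrite TropE; have [U [_ [g Ug] UE]] := barP a YX Gc oP f.
    rewrite (UE g Ug) => h; apply: ordt_rat; apply: contraTneq h => ->.
    by rewrite /ordt eqxx.
  have [w [wP wE wdiv]] := invValuation_extend fin; exists w => //; split=> // phi.
  have [[f g] /= [g0 ->]] := funfield_fracP phi.
  rewrite mulf_eq0 negb_or invr_eq0 wdiv // => /andP[f0 _].
  have {}f0 : f != 0 by apply: contraNneq f0 => ->; rewrite rmorph0.
  have [[q ->] [q' ->]] := (rat_val f f0, rat_val g g0).
  by exists (q - q'); rewrite rmorphB.
- exact: Trop_an_continuous.
- by move=> gamma; rewrite TropE /Trop_an seminorm_val_Kpoint.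
Qed.
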